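(* Let $\Omega\subset\mathbb{R}^n$ be a bounded $C^2$ domain, let $0\le f\in C^{\alpha}(\overline{\Omega})$, $f\not\equiv0$, for some $0<\alpha<1$, satisfy $$\delta_R=\inf_{B_R(x_0)}f>0$$ for some ball $B_R(x_0)=\{x\in\mathbb{R}^n:|x-x_0|<R\}\subset\Omega$, and let $0<g\in C^2((-\infty,1))$ satisfy $g'(s)\le 0$ and $\left(\frac1g\right)''(s)\ge0$ for all $s<1$. Let $\mu_R$ be the first (Dirichlet) eigenvalue of $-\Delta$ in $B_R(x_0)$ and let $\phi_R$ be the first positive eigenfunction of $-\Delta$ in $B_R(x_0)$ normalized such that $\int_{B_R(x_0)}\phi_R\,dx=1$. Let $\lambda_R=\frac{\mu_R}{\delta_R}\sup_{0\le s<1}s\,g(s)$. Then for any solution $u$ of (P) with initial value $u_0\ge0$ and $\lambda>\lambda_R$, the touchdown time $T_\lambda$ of $u$ satisfies $$T_\lambda\le\frac{1}{(\lambda-\lambda_R)\delta_R}\int_{E_1(0)}^1g(s)\,ds,\qquad\text{where } E_1(0)=\int_{B_R(x_0)}u_0\phi_R\,dx.$$ Moreover, if $g$ also satisfies $g(s)\to0$ as $s\nearrow1$, then there exists a constant $a_1<1$ such that if $u_0\ge0$ and $$\int_{B_R(x_0)}u_0\phi_R\,dx\ge a_1,$$ then for any solution $u$ of (P) with $\lambda>0$ and initial value $u_0$ we have $T_\lambda\le(1-a_1)/10$.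
   Context: (P) denotes the problem $u_t=\Delta u+\lambda f(x)/g(u)$ in $\Omega\times(0,T)$, $u=0$ on $\partial\Omega\times(0,T)$, $u(x,0)=u_0$ in $\Omega$, where $u_0\in L^1(\Omega)$ satisfies $u_0\le a$ in $\Omega$ for some constant $a\in(0,1)$. A solution of (P) in $\Omega\times(0,T)$ is a function $u\in C^{2,1}(\Omega\times(0,T))\cap C(\overline{\Omega}\times(0,T))$ (with $C^{2,1}$ meaning that $u,u_t,u_{x_i},u_{x_ix_j}$ are continuous) satisfying the equation, $u=0$ on $\partial\Omega\times(0,T)$, $\sup_{\overline{\Omega}\times(0,T']}u<1$ for all $0<T'<T$, and $\|u(\cdot,t)-u_0\|_{L^1(\Omega)}\to 0$ as $t\to 0$. The touchdown time $T_\lambda>0$ of a solution $u$ is the time such that $\sup_\Omega u(\cdot,t)<1$ for all $0<t<T_\lambda$ and $\lim_{t\nearrow T_\lambda}\sup_\Omega u(\cdot,t)=1$.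
   Formalization: In the second part the constant a_1 is allowed to depend on λ (for each λ>0 there is a_1<1); a single a_1 for all λ>0 is impossible, since for n=1, f=1, g=(1-s)^2, constant u_0≥a_1 and small λ the solution is global and never touches down. *)

(* Defs.v *)
From HB Require Import structures.
From mathcomp Require Import all_boot all_order all_algebra.
From mathcomp Require Import all_classical all_reals all_analysis.

Set Implicit Arguments.
Unset Strict Implicit.
Unset Printing Implicit Defensive.

Import Order.TTheory GRing.Theory Num.Theory.
Import numFieldNormedType.Exports.

Local Open Scope classical_set_scope.
Local Open Scope ring_scope.

(* 'rV[R]_n carries the product sigma-algebra generated by the coordinates,
   i.e. its Borel sigma-algebra.                                              *)
Definition measure_rV_display : measure_display. Proof. exact. Qed.

Section measurable_rV.
Context {R : realType}.
Variable n : nat.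

Definition rV_coord (i : 'I_n) (x : 'rV[R]_n) : measurableTypeR R := x ord0 i.

Let rV_set0 : g_sigma_preimage rV_coord set0.
Proof. exact: sigma_algebra0. Qed.

Let rV_setC A : g_sigma_preimage rV_coord A -> g_sigma_preimage rV_coord (~` A).
Proof. exact: sigma_algebraC. Qed.

Let rV_bigcup (F : _^nat) : (forall i, g_sigma_preimage rV_coord (F i)) ->
  g_sigma_preimage rV_coord (\bigcup_i (F i)).
Proof. exact: sigma_algebra_bigcup. Qed.

HB.instance Definition _ := @isMeasurable.Build measure_rV_display
  'rV[R]_n (g_sigma_preimage rV_coord) rV_set0 rV_setC rV_bigcup.

Lemma measurable_rV_coord (i : 'I_n) :
  measurable_fun [set: 'rV[R]_n] (rV_coord i).
Proof.
move=> _ Y mY; rewrite setTI; apply: sub_sigma_algebra => /=.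
rewrite -bigcup_seq/=; exists i => /=; first by rewrite mem_index_enum.
by exists Y => //; rewrite setTI.
Qed.

Lemma measurable_fun_rV d (T : measurableType d) (f : T -> 'rV[R]_n) :
  (forall i, measurable_fun [set: T] (rV_coord i \o f)) ->
  measurable_fun [set: T] f.
Proof.
move=> mf _ A mA; rewrite setTI.
suff: g_sigma_preimage rV_coord `<=` [set B | measurable (f @^-1` B)] by exact.
apply: smallest_sub.
  split => /=.
  - by rewrite preimage_set0.
  - by move=> B mB; rewrite setTD preimage_setC; exact: measurableC.
  - by move=> F mF; rewrite preimage_bigcup; exact: bigcup_measurable.
move=> B; rewrite -bigcup_seq => -[i _ [C mC <-]] /=.
by have := mf i measurableT C mC; rewrite !setTI.
Qed.

End measurable_rV.

Section lebesgue_rV.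
Context {R : realType}.

Definition cons_rV n (p : measurableTypeR R * 'rV[R]_n) : 'rV[R]_n.+1 :=
  row_mx (const_mx p.1 : 'rV[R]_1) p.2.

Definition uncons_rV n (x : 'rV[R]_n.+1) : measurableTypeR R * 'rV[R]_n :=
  (x ord0 ord0, \row_i x ord0 (lift ord0 i)).

Lemma cons_rVK n : cancel (@cons_rV n) (@uncons_rV n).
Proof.
move=> [a y]; rewrite /uncons_rV /cons_rV; congr (_, _) => /=.
  rewrite (_ : ord0 = lshift n (ord0 : 'I_1)); last exact/val_inj.
  by rewrite (@row_mxEl _ 1 1 n) mxE.
apply/rowP => i; rewrite mxE.
rewrite (_ : lift ord0 i = rshift 1 i); last exact/val_inj.
by rewrite (@row_mxEr _ 1 1 n).
Qed.

Lemma uncons_rVK n : cancel (@uncons_rV n) (@cons_rV n).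
Proof.
move=> x; apply/rowP => i; rewrite /cons_rV /uncons_rV /=.
case: (unliftP ord0 i) => [j ->|->].
  rewrite (_ : lift ord0 j = rshift 1 j); last exact/val_inj.
  rewrite (@row_mxEr _ 1 1 n) mxE; congr (x _ _); exact/val_inj.
rewrite (_ : ord0 = lshift n (ord0 : 'I_1)); last exact/val_inj.
by rewrite (@row_mxEl _ 1 1 n) mxE; congr (x _ _); exact/val_inj.
Qed.

Lemma measurable_cons_rV n : measurable_fun setT (@cons_rV n).
Proof.
apply: measurable_fun_rV => i.
case: (unliftP ord0 i) => [j ->|->].
  rewrite (_ : _ \o _ = rV_coord j \o snd).
    apply: measurableT_comp; first exact: measurable_rV_coord.
    exact: measurable_snd.
  apply/funext => p /=; rewrite /rV_coord /cons_rV.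
  rewrite (_ : lift ord0 j = rshift 1 j); last exact/val_inj.
  by rewrite (@row_mxEr _ 1 1 n).
rewrite (_ : _ \o _ = fst); first exact: measurable_fst.
apply/funext => p /=; rewrite /rV_coord /cons_rV.
rewrite (_ : ord0 = lshift n (ord0 : 'I_1)); last exact/val_inj.
by rewrite (@row_mxEl _ 1 1 n) mxE.
Qed.

Lemma measurable_uncons_rV n : measurable_fun setT (@uncons_rV n).
Proof.
apply: measurable_fun_pair => /=; first exact: (measurable_rV_coord ord0).
apply: measurable_fun_rV => i.
rewrite (_ : _ \o _ = rV_coord (lift ord0 i)); first exact: measurable_rV_coord.
by apply/funext => x; rewrite /rV_coord/= mxE.
Qed.

Section step.
Variables (n : nat) (mu : {sigma_finite_measure set 'rV[R]_n -> \bar R}).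

Definition lebesgue_consM : set 'rV[R]_n.+1 -> \bar R :=
  pushforward (@lebesgue_measure R \x mu)%E (@cons_rV n).

Let lebesgue_consM0 : lebesgue_consM set0 = 0%E.
Proof. by rewrite /lebesgue_consM /pushforward preimage_set0 measure0. Qed.

Let lebesgue_consM_ge0 A : (0 <= lebesgue_consM A)%E.
Proof. by apply: integral_ge0 => x _; exact: measure_ge0. Qed.

Let lebesgue_consM_sigma_additive : semi_sigma_additive lebesgue_consM.
Proof.
move=> F mF tF mUF; rewrite /lebesgue_consM /pushforward preimage_bigcup.
apply: measure_semi_sigma_additive.
- by move=> k; rewrite -[X in measurable X]setTI; exact: measurable_cons_rV.
- apply/trivIsetP => /= i j _ _ ij; rewrite -preimage_setI.
  by move/trivIsetP : tF => /(_ _ _ _ _ ij) ->//; rewrite preimage_set0.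
- by rewrite -preimage_bigcup -[X in measurable X]setTI;
    exact: measurable_cons_rV.
Qed.

HB.instance Definition _ := isMeasure.Build _ _ _ lebesgue_consM
  lebesgue_consM0 lebesgue_consM_ge0 lebesgue_consM_sigma_additive.

Lemma lebesgue_consM_sigma_finite : sigma_finite setT lebesgue_consM.
Proof.
have /sigma_finiteP[F [TF ndF Foo]] := sigma_finiteT (@lebesgue_measure R).
have /sigma_finiteP[G [TG ndG Goo]] := sigma_finiteT mu.
exists (fun k => @uncons_rV n @^-1` (F k `*` G k)).
  apply/esym/seteqP; split => // x _.
  have : [set: measurableTypeR R] (uncons_rV x).1 by [].
  rewrite TF => -[i _ Fi].
  have : [set: 'rV[R]_n] (uncons_rV x).2 by [].
  rewrite TG => -[j _ Gj].
  exists (maxn i j) => //; split.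
  - by move: Fi; exact/subsetPset/ndF/leq_maxl.
  - by move: Gj; exact/subsetPset/ndG/leq_maxr.
move=> k; have [mF Fk] := Foo k; have [mG Gk] := Goo k; split.
  by rewrite -[X in measurable X]setTI; apply: measurable_uncons_rV => //;
    exact: measurableX.
rewrite /lebesgue_consM /pushforward -comp_preimage.
rewrite (_ : _ \o _ = id); last by apply/funext => p /=; rewrite cons_rVK.
by rewrite preimage_id product_measure1E// lte_mul_pinfty// ge0_fin_numE.
Qed.

HB.instance Definition _ := Measure_isSigmaFinite.Build _ _ _ lebesgue_consM
  lebesgue_consM_sigma_finite.

Definition lebesgue_cons : {sigma_finite_measure set 'rV[R]_n.+1 -> \bar R} :=
  lebesgue_consM.

End step.

Definition lebesgue_rV0 : {sigma_finite_measure set 'rV[R]_0 -> \bar R} :=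
  \d_(0 : 'rV[R]_0).

Fixpoint lebesgue_rV (n : nat) :
    {sigma_finite_measure set 'rV[R]_n -> \bar R} :=
  match n with
  | 0 => lebesgue_rV0
  | m.+1 => lebesgue_cons (lebesgue_rV m)
  end.

Lemma lebesgue_rV_box n (A : 'I_n -> set (measurableTypeR R)) :
  (forall i, measurable (A i)) ->
  lebesgue_rV n [set x | forall i, A i (rV_coord i x)] =
  (\prod_(i < n) lebesgue_measure (A i))%E.
Proof.
elim: n A => [A _|n IHn A mA].
  by rewrite big_ord0 /= diracE mem_set// => -[].
have mB : measurable [set y : 'rV[R]_n |
    forall i, A (lift ord0 i) (rV_coord i y)].
  rewrite (_ : [set y | _] =
    \big[setI/setT]_(i < n) (rV_coord i @^-1` A (lift ord0 i))).
    apply: bigsetI_measurable => i _.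
    by rewrite -[X in measurable X]setTI; exact: measurable_rV_coord.
  rewrite -bigcap_seq; apply/seteqP; split => [y Ay i _|y Ay i]; first exact: Ay.
  by apply: (Ay i) => /=; rewrite mem_index_enum.
rewrite big_ord_recl -IHn// -[RHS]product_measure1E//.
congr (product_measure1 _ _ _); apply/seteqP.
have c0 (a : measurableTypeR R) (y : 'rV[R]_n) :
    rV_coord ord0 (cons_rV (a, y)) = a.
  exact: (congr1 fst (@cons_rVK n (a, y))).
have cl (a : measurableTypeR R) (y : 'rV[R]_n) j :
    rV_coord (lift ord0 j) (cons_rV (a, y)) = rV_coord j y.
  have /rowP/(_ j) := congr1 snd (@cons_rVK n (a, y)).
  by rewrite mxE.
split => [[a y] /= Ay|[a y] [/= Aa Ay] i].
  split => [|i] /=; first by have := Ay ord0; rewrite c0.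
  by have := Ay (lift ord0 i); rewrite cl.
by case: (unliftP ord0 i) => [j ->|->]; rewrite ?cl ?c0.
Qed.

End lebesgue_rV.

Section pde.
Context {R : realType}.
Implicit Types (n : nat) (T : \bar R).

(* The library norm on 'rV[R]_n is the sup norm; it induces the same topology,
   but balls and moduli of continuity below are Euclidean.                    *)
Definition euclid_norm n (x : 'rV[R]_n) : R :=
  Num.sqrt (\sum_(i < n) x ord0 i ^+ 2).

Definition euclid_ball n (x0 : 'rV[R]_n) (r : R) : set 'rV[R]_n :=
  [set x | euclid_norm (x - x0) < r].

Definition boundary (X : topologicalType) (A : set X) : set X :=
  closure A `\` interior A.

Definition partial n (i : 'I_n) (F : 'rV[R]_n -> R) : 'rV[R]_n -> R :=
  fun x => 'D_(delta_mx ord0 i) F x.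

Definition laplacian n (F : 'rV[R]_n -> R) (x : 'rV[R]_n) : R :=
  \sum_(i < n) partial i (partial i F) x.

(* Only meant for U open: continuity is required in a full neighbourhood. *)
Definition C2_on n (U : set 'rV[R]_n) (F : 'rV[R]_n -> R) : Prop :=
  forall x, U x ->
  [/\ {for x, continuous F},
      (forall i, derivable F x (delta_mx ord0 i) /\
                 {for x, continuous (partial i F)}) &
      (forall i j, derivable (partial i F) x (delta_mx ord0 j) /\
                   {for x, continuous (partial j (partial i F))})].

Definition C2_lt1 (g : R -> R) : Prop :=
  forall s, s < 1 ->
  [/\ derivable g s 1, derivable (derive1 g) s 1 &
      {for s, continuous (derive1n 2 g)}].

(* Near each boundary point, after relabelling and reorienting the axes, the set
   lies above the graph of a C^2 function: coordinate i, oriented by the sign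
   (-1)^b, is the vertical one and col' i x lists the other n - 1.            *)
Definition C2_boundary n (Om : set 'rV[R]_n) : Prop :=
  forall x0, boundary Om x0 ->
  exists (r : R) (i : 'I_n) (b : bool) (gam : 'rV[R]_n.-1 -> R),
  [/\ 0 < r, C2_on setT gam &
      Om `&` euclid_ball x0 r =
      [set x : 'rV[R]_n | 0 < (-1) ^+ b * (x ord0 i - gam (col' i x))]
        `&` euclid_ball x0 r].

Definition bounded_C2_domain n (Om : set 'rV[R]_n) : Prop :=
  [/\ open Om, connected Om, bounded_set Om & C2_boundary Om].

Definition holder_on n (A : set 'rV[R]_n) (alpha : R) (f : 'rV[R]_n -> R) :
    Prop :=
  exists C : R, forall x y, A x -> A y ->
    `|f x - f y| <= C * euclid_norm (x - y) `^ alpha.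

Definition dirichlet_eigenfunction n (B : set 'rV[R]_n) (mu : R)
    (phi : 'rV[R]_n -> R) : Prop :=
  [/\ C2_on B phi,
      {within closure B, continuous phi},
      (forall x, B x -> - laplacian phi x = mu * phi x),
      (forall x, boundary B x -> phi x = 0) &
      (exists2 x, B x & phi x != 0)].

Definition dirichlet_eigenvalue n (B : set 'rV[R]_n) (mu : R) : Prop :=
  exists phi, dirichlet_eigenfunction B mu phi.

Definition first_dirichlet_eigenvalue n (B : set 'rV[R]_n) (mu : R) : Prop :=
  dirichlet_eigenvalue B mu /\
  forall nu, dirichlet_eigenvalue B nu -> mu <= nu.

(* The interval (0, T), where T may be +oo. *)
Definition time_interval T : set R := [set t | 0 < t /\ (t%:E < T)%E].

Definition C21_on n (Om : set 'rV[R]_n) T (u : 'rV[R]_n -> R -> R) : Prop :=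
  forall x t, Om x -> time_interval T t ->
  [/\ {for (x, t), continuous (fun p : 'rV[R]_n * R => u p.1 p.2)},
      derivable (u x) t 1 /\
        {for (x, t), continuous (fun p : 'rV[R]_n * R => derive1 (u p.1) p.2)},
      (forall i, derivable (u ^~ t) x (delta_mx ord0 i) /\
        {for (x, t), continuous
          (fun p : 'rV[R]_n * R => partial i (u ^~ p.2) p.1)}) &
      (forall i j, derivable (partial i (u ^~ t)) x (delta_mx ord0 j) /\
        {for (x, t), continuous
          (fun p : 'rV[R]_n * R => partial j (partial i (u ^~ p.2)) p.1)})].

(* u0 represents an element of L^1(Om), so pointwise bounds hold a.e. *)
Definition initial_datum n (Om : set 'rV[R]_n) (u0 : 'rV[R]_n -> R) : Prop :=
  (lebesgue_rV n).-integrable Om (EFin \o u0) /\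
  exists a : R, [/\ 0 < a, a < 1 &
    {ae lebesgue_rV n, forall x, Om x -> u0 x <= a}].

(* u_t = Delta u + lam f / g(u) in Om x (0, T), u = 0 on the lateral boundary,
   u(., 0) = u0. Suprema of u are taken in \bar R because the real-valued sup of
   an unbounded set is 0.                                                     *)
Record solution n (Om : set 'rV[R]_n) (f : 'rV[R]_n -> R) (g : R -> R)
    (lam : R) (u0 : 'rV[R]_n -> R) T (u : 'rV[R]_n -> R -> R) : Prop := {
  sol_T_gt0 : (0 < T)%E ;
  sol_C21 : C21_on Om T u ;
  sol_continuous : {within closure Om `*` time_interval T,
    continuous (fun p : 'rV[R]_n * R => u p.1 p.2)} ;
  sol_equation : forall x t, Om x -> time_interval T t ->
    derive1 (u x) t = laplacian (u ^~ t) x + lam * (f x / g (u x t)) ;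
  sol_boundary : forall x t, boundary Om x -> time_interval T t -> u x t = 0 ;
  sol_lt1 : forall T' : R, time_interval T T' ->
    (ereal_sup [set (u p.1 p.2)%:E |
      p in closure Om `*` [set t | (0 < t <= T')%R]] < 1)%E ;
  sol_initial :
    (\int[lebesgue_rV n]_(x in Om) `|u x t - u0 x|%:E)%E @[t --> 0^'+] --> 0%E
}.

Definition space_sup n (Om : set 'rV[R]_n) (u : 'rV[R]_n -> R -> R) (t : R) :
    \bar R :=
  ereal_sup [set (u x t)%:E | x in Om].

(* By convention a solution that exists globally and never touches down has
   touchdown time +oo. *)
Definition touchdown_time n (Om : set 'rV[R]_n) (u : 'rV[R]_n -> R -> R) T :
    Prop :=
  [/\ (0 < T)%E,
      (forall t, time_interval T t -> (space_sup Om u t < 1)%E) &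
      (forall r : R, T = r%:E -> space_sup Om u t @[t --> r^'-] --> 1%E)].

End pde.

(* Main.v *)
Require Import Defs.
From mathcomp Require Import all_boot all_order all_algebra.
From mathcomp Require Import all_classical all_reals all_analysis.
From mathcomp Require Import measurable_realfun.
From mathcomp Require Import ring lra.

Set Implicit Arguments.
Unset Strict Implicit.
Unset Printing Implicit Defensive.

Import Order.TTheory GRing.Theory Num.Theory.
Import numFieldNormedType.Exports.

Local Open Scope classical_set_scope.
Local Open Scope ring_scope.

(** Testing the equation against phi gives, for E(t) = \int_B u(t) phi, the
    inequality E' >= - mu E + lam delta / g(E): Green's formula for the Laplacian,
    Jensen's inequality for the convex function 1/g. By the choice of lamR its
    right-hand side is at least (lam - lamR) delta / g(E), and integrating
    g(E) E' >= (lam - lamR) delta bounds the touchdown time. For the second part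
    one linearises 1/g at a point a1 with lam delta / g(a1) - mu >= 10: then E
    never falls below a1, by Gronwall, so that E' >= 10.

    Neither u nor phi need be C^1 up to the boundary of B. Hence phi is replaced by
    h(phi) with h convex, 0 <= h' <= 1 and h = 0 on [0, e]: h(phi) has compact
    support in B and Delta h(phi) >= - mu phi, so Green's formula is needed only
    for compactly supported functions, where it is Fubini's theorem together with
    the fundamental theorem of calculus; e tends to 0 only in the integrated
    inequality. The sign condition u >= 0 is obtained from Kato's inequality,
    since the initial datum is attained in L^1 only. *)

(** * Measurability and integrability on ['rV[R]_n] *)

Section rV_measure.
Context {R : realType}.

(** The ball may touch the boundary of the domain, and near the boundary of [B] neither [u_t] nor
    the gradients are controlled. So E itself is never differentiated: every differential inequality
    is stated for the approximant y = \int u h(phi), with E on its right-hand side and an error C e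
    where C is independent of e. Such a C exists because u stays below some m < 1 up to any time b
    before T: replacing phi by h(phi) costs at most 2e, hence O(e / g(m)) in the reaction term. The
    sign of u matters because u multiplies the inequality Delta h(phi) >= - mu phi.

    Jensen's inequality enters through tangents, 1/g(u) >= G(s0) + G'(s0) (u - s0) with G = 1/g, and
    s0 is left free in the integrated inequality. Taking s0 = E(t) removes the linear term and gives
    the integral bound; a constant s0 = a1 keeps a linear term whose sign is that of E - a1, which
    is why E >= a1 has to be established before the growth rate.

    Integration in time starts at a small positive time s with E(s) close to its initial value, and
    the errors made there vanish with those coming from e. *)

Definition cube n (M : R) : set 'rV[R]_n :=
  [set x | forall i, `|x ord0 i| <= M].

Lemma rV_ballP n (x y : 'rV[R]_n) (e : R) :
  ball x e y <-> 0 < e /\ forall i, `|x ord0 i - y ord0 i| < e.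
Proof.
split=> [[e0 H]|[e0 H]]; split=> //; first by move=> i; exact: H.
by move=> i j; rewrite (ord1 i); exact: H.
Qed.

Lemma open_rVP n (U : set 'rV[R]_n) : open U ->
  forall x, U x -> exists2 e : R, 0 < e &
    forall y : 'rV[R]_n, (forall i, `|x ord0 i - y ord0 i| < e) -> U y.
Proof.
move=> oU x Ux; have /nbhs_ballP[e /= e0 He] := open_nbhs_nbhs (conj oU Ux).
by exists e => // y Hy; apply: He; apply/rV_ballP.
Qed.

Lemma measurable_rV_box n (A : 'I_n -> set (measurableTypeR R)) :
  (forall i, measurable (A i)) ->
  measurable [set x : 'rV[R]_n | forall i, A i (rV_coord i x)].
Proof.
move=> mA; rewrite (_ : [set y | _] =
    \big[setI/setT]_(i < n) (rV_coord i @^-1` A i)).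
  apply: bigsetI_measurable => i _.
  by rewrite -[X in measurable X]setTI; exact: measurable_rV_coord.
rewrite -bigcap_seq; apply/seteqP; split => [y Ay i _|y Ay i]; first exact: Ay.
by apply: (Ay i) => /=; rewrite mem_index_enum.
Qed.

(** The sigma-algebra is generated by the coordinates, so an open set has to be exhibited as a
    countable union: of the boxes it contains that have a rational centre and half-width 1/(k+1). *)
Lemma open_measurable_rV n (U : set 'rV[R]_n) : open U -> measurable U.
Proof.
move=> oU.
pose box (p : 'rV[rat]_n * nat) : set 'rV[R]_n :=
  [set y | forall i, (ball (ratr (p.1 ord0 i) : R) p.2.+1%:R^-1 : set (measurableTypeR R))
                       (rV_coord i y)].
have mbox p : measurable (box p).
  have mb (i : 'I_n) : measurable (ball (ratr (p.1 ord0 i) : R) p.2.+1%:R^-1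
      : set (measurableTypeR R)).
    by rewrite ball_itv; exact: measurable_itv.
  exact: (measurable_rV_box mb).
rewrite (_ : U = \bigcup_p (if `[< box p `<=` U >] then box p else set0)).
  apply: countable_bigcupT_measurable; first exact: countableP.
  by move=> p; case: asboolP.
apply/seteqP; split=> [x Ux|x [p _]]; last by case: asboolP => // s; exact: s.
have [e e0 He] := open_rVP oU Ux.
(* Half of e, because x and y are each within 1/(k+1) of the rational centre. *)
have /ltr_add_invr[k] : 0 < e / 2 by rewrite divr_gt0.
rewrite add0r => ke.
have : 0 < k.+1%:R^-1 :> R by [].
set c := k.+1%:R^-1 in ke * => c0.
have /choice[q Hq] : forall i, exists q : rat,
    `|x ord0 i - ratr q| < c.
  move=> i; have : x ord0 i - c < x ord0 i + c.
    by lra.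
  move=> /rat_in_itvoo[q]; rewrite in_itv/= => /andP[q1 q2]; exists q.
  by rewrite ltr_norml; apply/andP; split; lra.
exists (\row_i q i, k) => //; case: asboolP => [_ i|[]].
  by rewrite /ball/= mxE distrC; exact: Hq.
move=> y Hy; apply: He => i.
have := Hy i; rewrite /ball/= mxE /rV_coord -/c => h1.
rewrite (_ : _ - _ = (x ord0 i - ratr (q i)) + (ratr (q i) - y ord0 i)); last by ring.
apply: (le_lt_trans (ler_normD _ _)).
by apply: (lt_le_trans (ltrD (Hq i) h1)); lra.
Qed.

Lemma open_continuous_measurable_rV n (U : set 'rV[R]_n) (F : 'rV[R]_n -> R) :
  open U -> (forall x, U x -> {for x, continuous F}) -> measurable_fun U F.
Proof.
move=> oU cF; apply: (measurability _ (RGenOpens.measurableE R)).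
move=> /= _ [_ [a [b ->] <-]]; apply: open_measurable_rV.
rewrite openE => x [Ux /= Fx]; apply: filterI; first exact: open_nbhs_nbhs.
by apply: (cF x Ux); apply: open_nbhs_nbhs; split => //; exact: interval_open.
Qed.

Lemma continuous_measurable_rV n (F : 'rV[R]_n -> R) :
  continuous F -> measurable_fun setT F.
Proof. by move=> cF; apply: open_continuous_measurable_rV => [|x _]; [exact: openT|exact: cF]. Qed.

Lemma measurable_cube n M : measurable (@cube n M).
Proof.
apply: (@measurable_rV_box n (fun=> [set a : measurableTypeR R | `|a| <= M])) => i.
rewrite (_ : [set a | _] = `[-M, M]%classic); first exact: measurable_itv.
by apply/seteqP; split=> x /=; rewrite in_itv/= ler_norml.
Qed.

Lemma cube_lty n M : (lebesgue_rV n (cube M) < +oo)%E.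
Proof.
have cE : [set a : measurableTypeR R | `|a| <= M] = `[-M, M]%classic.
  by apply/seteqP; split=> x /=; rewrite in_itv/= ler_norml.
have -> : @cube n M = [set x : 'rV[R]_n | forall i,
    [set a : measurableTypeR R | `|a| <= M] (rV_coord i x)] by [].
rewrite (@lebesgue_rV_box R n (fun=> [set a : measurableTypeR R | `|a| <= M]))
  => [|i]; rewrite cE; last exact: measurable_itv.
rewrite big_const; elim: #|_| => [|k IH] /=; first by rewrite ltry.
by rewrite lte_mul_pinfty// ?ge0_fin_numE// lebesgue_measure_itv/=;
  case: ifP => // _; rewrite ?ltry// lee_fin; lra.
Qed.

Lemma bounded_cube n (A : set 'rV[R]_n) : bounded_set A ->
  exists2 M, 0 < M & A `<=` cube M.
Proof.
move=> [M [_ HM]]; exists (`|M| + 1); first by rewrite ltr_wpDl.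
have /HM{}HM : M < `|M| + 1 by rewrite ltr_pwDr// ler_norm.
move=> x /HM xM i; apply: le_trans xM.
rewrite [leRHS]/Num.norm /= mx_normrE; apply/bigmax_geP; right => /=.
by exists (ord0, i).
Qed.

Lemma integrable_rV_bounded n (U : set 'rV[R]_n) (F : 'rV[R]_n -> R) (C : R) :
  bounded_set U -> measurable U -> measurable_fun U F ->
  (forall x, U x -> `|F x| <= C) ->
  (lebesgue_rV n).-integrable U (EFin \o F).
Proof.
move=> /bounded_cube[M _ UM] mU mF FC.
apply: measurable_bounded_integrable => //.
  by apply: le_lt_trans (cube_lty n M); apply: le_measure => //;
     rewrite inE//; exact: measurable_cube.
exists C; split; first exact: num_real.
by move=> y Cy x Ux; apply: le_trans (ltW Cy); exact: FC.
Qed.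

End rV_measure.

(** * Fubini's theorem on row vectors *)

Section fubini_rV.
Context {R : realType}.

Lemma integrable_rV_cube n (F : 'rV[R]_n -> R) (C M : R) :
  measurable_fun setT F -> (forall x, `|F x| <= C) ->
  (forall x, ~ cube M x -> F x = 0) ->
  (lebesgue_rV n).-integrable setT (EFin \o F).
Proof.
move=> mF FC F0.
have mM := @measurable_cube R n M.
have -> : EFin \o F = (EFin \o F) \_ (cube M).
  by apply/funext => x; rewrite patchE; case: ifPn => //= /negP;
     rewrite inE => /F0 ->.
apply: (integrable_mkcond _ mM).1.
apply: measurable_bounded_integrable => //; first exact: cube_lty.
- exact: measurable_funTS.
- exists C; split; first exact: num_real.
  by move=> y Cy x _; apply: le_trans (ltW Cy); exact: FC.
Qed.

(** The measure in dimension n+1 is by construction the image of a product measure under [cons_rV],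
    so Fubini's theorem transfers. Both orders are kept, since the coordinate that is differentiated
    has to be integrated innermost. *)
Lemma integral_cons_rV n (F : 'rV[R]_n.+1 -> R) :
  measurable_fun setT F -> (lebesgue_rV n.+1).-integrable setT (EFin \o F) ->
  (\int[lebesgue_rV n.+1]_x (F x)%:E =
     \int[lebesgue_measure]_a \int[lebesgue_rV n]_y (F (cons_rV (a, y)))%:E)%E /\
  (\int[lebesgue_rV n.+1]_x (F x)%:E =
     \int[lebesgue_rV n]_y \int[lebesgue_measure]_a (F (cons_rV (a, y)))%:E)%E.
Proof.
move=> mF iF.
have /measurable_EFinP mEF := mF.
have mc := @measurable_cons_rV R n.
pose P := (@lebesgue_measure R \x lebesgue_rV n)%E.
have iP : P.-integrable setT ((EFin \o F) \o @cons_rV R n).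
  apply/integrableP; split; first exact: measurableT_comp.
  move/integrableP : iF => [_]; apply: le_lt_trans.
  rewrite (@ge0_integral_pushforward _ _ _ _ _ _ mc P setT (abse \o (EFin \o F)))//=.
  by apply: measurableT_comp => //.
have -> : (\int[lebesgue_rV n.+1]_x (F x)%:E =
    \int[P]_p (F (cons_rV p))%:E)%E.
  exact: (@integral_pushforward _ _ _ _ _ _ mc P setT (EFin \o F) mEF iP measurableT).
by split; [rewrite -(integral12_prod_meas1 iP)|rewrite -(integral21_prod_meas1 iP)].
Qed.

End fubini_rV.

(** * Integration by parts *)

Section one_dimensional_derivatives.
Context {R : realType}.

(** Both difference quotients are the same function of h; this carries one-variable calculus over to
    directional derivatives. *)
Lemma derivable_lineP (V : normedModType R) (F : V -> R) (x v : V) (t : R) :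
  (derivable F (t *: v + x) v <->
   derivable (fun s : R => F (s *: v + x)) t 1) /\
  'D_v F (t *: v + x) = 'D_1 (fun s : R => F (s *: v + x)) t.
Proof.
have E : (fun h : R => h^-1 *: ((F \o shift (t *: v + x)) (h *: v) - F (t *: v + x)))
  = (fun h : R => h^-1 *: (((fun s : R => F (s *: v + x)) \o shift t) (h *: 1)
       - (fun s : R => F (s *: v + x)) t)).
  apply/funext => h /=; congr (_ *: (F _ - _)).
  by rewrite addrA -scalerDl /GRing.scale/= mulr1.
by rewrite /derivable /derive E.
Qed.

Lemma is_derive1_continuous (h dh : R -> R) :
  (forall s : R, is_derive s 1 h (dh s)) -> continuous h.
Proof. by move=> D s; apply/differentiable_continuous/derivable1_diffP; case: (D s). Qed.

Lemma derive_near0 (V : normedModType R) (F : V -> R) (x v : V) :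
  (\forall y \near x, F y = 0) -> derivable F x v /\ 'D_v F x = 0.
Proof.
move=> F0; have [] : is_derive x v F 0; last by move=> ? ?; split.
apply: (@near_eq_is_derive _ _ _ (cst 0)).
by apply: filterS F0 => y ->.
Qed.

Lemma integral_derive1_eq0 (f : R -> R) (M : R) :
  (forall x, derivable f x 1) -> continuous (derive1 f) ->
  (forall x, M < `|x| -> f x = 0) ->
  (\int[lebesgue_measure]_x (derive1 f x)%:E = 0)%E.
Proof.
move=> df cf' f0.
(* A positive bound beyond M: f vanishes at both endpoints and its derivative vanishes outside
   [-N, N]. *)
pose N : R := `|M| + 1.
have N0 : 0 < N by rewrite ltr_wpDl.
have MN : M < N by rewrite ltr_pwDr// ler_norm.
have -> : (\int[lebesgue_measure]_x (derive1 f x)%:E =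
   \int[lebesgue_measure]_(x in `[(- N)%R, N]) (derive1 f x)%:E)%E.
  rewrite [RHS]integral_mkcond; apply: eq_integral => x _.
  rewrite patchE; case: ifPn => // /negP; rewrite inE/= in_itv/= -ler_norml.
  move=> /negP; rewrite -ltNge => Nx; congr EFin.
  rewrite derive1E; apply: (derive_near0 _ _).2.
  have : \forall y \near x, N < `|y|.
    by apply: (@cvgr_norm_gt _ R^o R (nbhs x) _ id x).
  by apply: filterS => y Ny; apply: f0; exact: lt_trans Ny.
rewrite (@continuous_FTC2 _ _ f).
- by rewrite !f0 ?subee// ?normrN gtr0_norm.
- by rewrite gtrN.
- exact: continuous_subspaceT.
- split; first by move=> x _; exact: df.
  + by apply: cvg_at_right_filter; apply: differentiable_continuous; apply/derivable1_diffP.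
  + by apply: cvg_at_left_filter; apply: differentiable_continuous; apply/derivable1_diffP.
- by [].
Qed.

End one_dimensional_derivatives.

(** * Integrals of partial derivatives *)

Section integral_partial.
Context {R : realType}.

Lemma cons_rV0 n (a : R) (y : 'rV[R]_n) : cons_rV (a, y) ord0 ord0 = a.
Proof. exact: (congr1 fst (@cons_rVK R n (a, y))). Qed.

Lemma cons_rV_lift n (a : R) (y : 'rV[R]_n) j :
  cons_rV (a, y) ord0 (lift ord0 j) = y ord0 j.
Proof. by have /rowP/(_ j) := congr1 snd (@cons_rVK R n (a, y)); rewrite mxE. Qed.

Lemma cons_rV_line0 n (a : R) (y : 'rV[R]_n) :
  cons_rV (a, y) = a *: delta_mx ord0 ord0 + cons_rV (0, y).
Proof.
apply/rowP => i; rewrite [RHS]mxE [X in _ = X + _]mxE [X in _ = _ * X + _]mxE.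
case: (unliftP ord0 i) => [j ->|->].
  by rewrite !cons_rV_lift eqxx andTb eq_sym (negbTE (neq_lift _ _)) mulr0 add0r.
by rewrite !cons_rV0 !eqxx mulr1 addr0.
Qed.

Lemma cons_rV_lineS n (a h : R) (j : 'I_n) (y : 'rV[R]_n) :
  cons_rV (a, h *: delta_mx ord0 j + y) =
  h *: delta_mx ord0 (lift ord0 j) + cons_rV (a, y).
Proof.
apply/rowP => i; rewrite [RHS]mxE [X in _ = X + _]mxE [X in _ = _ * X + _]mxE.
case: (unliftP ord0 i) => [k ->|->].
  by rewrite !cons_rV_lift !mxE (inj_eq lift_inj).
by rewrite !cons_rV0 (negbTE (neq_lift _ _)) andbF mulr0 add0r.
Qed.

Lemma continuous_cons_rV n (a : R) : continuous (fun y : 'rV[R]_n => cons_rV (a, y)).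
Proof.
move=> y A /nbhs_ballP[e /= e0 He]; apply/nbhs_ballP; exists e => // z.
move=> /rV_ballP[_ yz]; apply: He; apply/rV_ballP; split=> // i.
case: (unliftP ord0 i) => [k ->|->]; first by rewrite !cons_rV_lift.
by rewrite !cons_rV0 subrr normr0.
Qed.

Lemma partial_near0 n (i : 'I_n) (F : 'rV[R]_n -> R) M :
  (forall x, ~ cube M x -> F x = 0) -> forall x, ~ cube M x -> partial i F x = 0.
Proof.
move=> F0 x /existsNP[k /negP]; rewrite -ltNge => Mx.
apply: (derive_near0 _ _).2.
have ck := @coord_continuous R 1 n ord0 k x.
have : \forall y \near x, M < `|(y : 'rV[R]_n) ord0 k|.
  exact: (@cvgr_norm_gt _ R^o _ (nbhs x) _ _ _ ck).
by apply: filterS => y My; apply: F0 => /(_ k); rewrite leNgt My.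
Qed.

Lemma compact_cube n (M : R) : compact (@cube R n M).
Proof.
have -> : @cube R n M = [set v : 'rV[R]_n | forall i, `[-M, M]%classic (v ord0 i)].
  by apply/seteqP; split=> v Hv i; have := Hv i; rewrite /= in_itv/= ler_norml.
by apply: (@rV_compact _ n (fun=> `[-M, M]%classic)) => _; exact: segment_compact.
Qed.

Lemma continuous_cube_bounded n (F : 'rV[R]_n -> R) (M : R) :
  continuous F -> (forall x, ~ cube M x -> F x = 0) ->
  exists C, forall x, `|F x| <= C.
Proof.
move=> cF F0.
have [C [_ HC]] := compact_bounded (continuous_compact (continuous_subspaceT cF) (@compact_cube n M)).
exists (`|C| + 1) => x.
have [Mx|nMx] := pselect (cube M x); last by rewrite F0// normr0 addr_ge0.
have CC : C < `|C| + 1 by rewrite ltr_pwDr// ler_norm.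
by apply: (HC _ CC); exists x.
Qed.

(** Induction on the dimension. For a later coordinate the first one is frozen and the induction
    hypothesis applies to the slice; the first coordinate itself is integrated innermost, by the
    fundamental theorem of calculus. *)
Lemma integral_partial_eq0 n (i : 'I_n) (F : 'rV[R]_n -> R) (M : R) :
  (forall x, derivable F x (delta_mx ord0 i)) -> continuous (partial i F) ->
  (forall x, ~ cube M x -> F x = 0) ->
  (\int[lebesgue_rV n]_x (partial i F x)%:E = 0)%E.
Proof.
elim: n i F => [[]//|n IH] i F dF cF F0.
have [C FC] := continuous_cube_bounded cF (partial_near0 i F0).
have mF := continuous_measurable_rV cF.
have iF := integrable_rV_cube mF FC (partial_near0 i F0).
have [fub1 fub2] := integral_cons_rV mF iF.
case: (unliftP ord0 i) => [j|] ij.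
  rewrite fub1 -[RHS](integral0 lebesgue_measure setT); apply: eq_integral => a _.
  pose G (y : 'rV[R]_n) := F (cons_rV (a, y)).
  have GE y : (derivable F (cons_rV (a, y)) (delta_mx ord0 i) ->
      derivable G y (delta_mx ord0 j)) /\ partial i F (cons_rV (a, y)) = partial j G y.
    rewrite /partial /derivable /derive.
    suff -> : (fun h : R => h^-1 *: ((F \o shift (cons_rV (a, y))) (h *: delta_mx ord0 i)
        - F (cons_rV (a, y)))) =
      (fun h : R => h^-1 *: ((G \o shift y) (h *: delta_mx ord0 j) - G y)) by [].
    by apply/funext => h; rewrite /= /G cons_rV_lineS ij.
  under eq_integral do rewrite (GE _).2.
  apply: IH.
  - by move=> y; apply: (GE y).1.
  - rewrite (_ : partial j G = partial i F \o (fun y => cons_rV (a, y))).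
      by move=> y; apply: continuous_comp; [exact: continuous_cons_rV|exact: cF].
    by apply/funext => y; rewrite /= (GE y).2.
  - move=> y nMy; apply: F0 => My; apply: nMy => k.
    by have := My (lift ord0 k); rewrite cons_rV_lift.
rewrite fub2 -[RHS](integral0 (lebesgue_rV n) setT); apply: eq_integral => y _.
pose f (s : R) := F (s *: delta_mx ord0 i + cons_rV (0, y)).
have fE a : partial i F (cons_rV (a, y)) = derive1 f a.
  by rewrite derive1E -(derivable_lineP _ _ _ _).2 /partial cons_rV_line0 ij.
under eq_integral do rewrite fE.
apply: (@integral_derive1_eq0 _ _ M).
- by move=> a; apply: (derivable_lineP _ _ _ _).1.1; exact: dF.
- rewrite (_ : derive1 f = partial i F \o (fun a => a *: delta_mx ord0 i + cons_rV (0, y))).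
    move=> a; apply: continuous_comp; last exact: cF.
    by apply: continuousD; [exact: scalel_continuous|exact: cst_continuous].
  by apply/funext => a; rewrite -fE /comp ij -cons_rV_line0.
- move=> a Ma; rewrite /f ij -cons_rV_line0; apply: F0 => /(_ ord0).
  by rewrite cons_rV0 leNgt Ma.
Qed.

End integral_partial.

(** * Functions with compact support in an open set *)

Section compact_support.
Context {R : realType}.

(** Since U and the complement of K are open and cover the space, near every point the extension of
    w by zero is either w itself or 0; the regularity of the extension follows from this
    alternative. *)
Lemma near_patch (V : topologicalType) (U K : set V) (w : V -> R) :
  open U -> closed K -> K `<=` U -> (forall x, U x -> ~ K x -> w x = 0) ->
  forall x, (U x /\ \forall y \near x, w y = (w \_ U) y) \/
            (\forall y \near x, (w \_ U) y = 0).
Proof.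
move=> oU cK KU w0 x.
have [Ux|nUx] := pselect (U x).
  left; split=> //; have : nbhs x U by apply: open_nbhs_nbhs.
  by apply: filterS => y Uy; rewrite patchE mem_set.
right; have : nbhs x (~` K).
  by apply: open_nbhs_nbhs; split; [exact: closed_openC|move=> /KU].
apply: filterS => y nKy; rewrite patchE; case: ifPn => //.
by rewrite inE => Uy; exact: w0.
Qed.

Lemma continuous_patch0 (V : topologicalType) (U K : set V) (w : V -> R) :
  open U -> closed K -> K `<=` U -> (forall x, U x -> ~ K x -> w x = 0) ->
  (forall x, U x -> {for x, continuous w}) -> continuous (w \_ U).
Proof.
move=> oU cK KU w0 cw x.
have [[Ux E]|E] := near_patch oU cK KU w0 x.
  have cwx : w @ x --> w x := cw _ Ux.
  rewrite /continuous_at -(nbhs_singleton E).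
  by apply: cvg_trans cwx; apply: near_eq_cvg; exact: E.
rewrite /continuous_at (nbhs_singleton E).
have c0 : (fun _ : V => 0 : R) y @[y --> x] --> (0 : R) by exact: cvg_cst.
apply: cvg_trans c0.
by apply: near_eq_cvg; apply: filterS E => y ->.
Qed.

Lemma compact_support_bounded n (U K : set 'rV[R]_n) (w : 'rV[R]_n -> R) :
  open U -> bounded_set U -> closed K -> K `<=` U ->
  (forall x, U x -> {for x, continuous w}) ->
  (forall x, U x -> ~ K x -> w x = 0) ->
  exists C, forall x, U x -> `|w x| <= C.
Proof.
move=> oU /bounded_cube[M _ UM] cK KU cw w0.
have [C HC] := continuous_cube_bounded
  (continuous_patch0 oU cK KU w0 cw) (M := M) (fun x nMx => 
   ltac:(by rewrite patchE memNset// => /UM)).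
by exists C => x Ux; have := HC x; rewrite patchE mem_set.
Qed.

Lemma integrable_compact_support n (U K : set 'rV[R]_n) (w : 'rV[R]_n -> R) :
  open U -> bounded_set U -> closed K -> K `<=` U ->
  (forall x, U x -> {for x, continuous w}) ->
  (forall x, U x -> ~ K x -> w x = 0) ->
  (lebesgue_rV n).-integrable U (EFin \o w).
Proof.
move=> oU bU cK KU cw w0.
have [C HC] := compact_support_bounded oU bU cK KU cw w0.
apply: (integrable_rV_bounded bU (open_measurable_rV oU) _ HC).
exact: open_continuous_measurable_rV.
Qed.

Lemma Rintegral_partial_eq0 n (i : 'I_n) (U K : set 'rV[R]_n)
    (F : 'rV[R]_n -> R) :
  open U -> bounded_set U -> closed K -> K `<=` U ->
  (forall x, U x -> derivable F x (delta_mx ord0 i)) ->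
  (forall x, U x -> {for x, continuous (partial i F)}) ->
  (forall x, U x -> ~ K x -> F x = 0) ->
  \int[lebesgue_rV n]_(x in U) partial i F x = 0.
Proof.
move=> oU /bounded_cube[M _ UM] cK KU dF cF F0.
have dF0 x : U x -> ~ K x -> partial i F x = 0.
  move=> Ux nKx; apply: (derive_near0 _ _).2.
  have : nbhs x (U `&` ~` K).
    by apply: open_nbhs_nbhs; split => //; apply: openI => //; exact: closed_openC.
  by apply: filterS => y [Uy nKy]; exact: F0.
have PE : partial i (F \_ U) = (partial i F) \_ U.
  apply/funext => x; rewrite patchE.
  have [[Ux E]|E] := near_patch oU cK KU F0 x.
    by rewrite mem_set//; apply/esym; exact: near_eq_derive.
  rewrite {1}/partial (derive_near0 _ E).2; case: ifPn => //.
  rewrite inE => Ux; apply/esym/(derive_near0 _ _).2.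
  have : nbhs x U by apply: open_nbhs_nbhs.
  by apply: filterS2 E => y; rewrite patchE => + Uy; rewrite mem_set.
rewrite Rintegral_mkcond -PE /Rintegral (@integral_partial_eq0 _ _ _ _ M)//.
- move=> x; have [[Ux E]|E] := near_patch oU cK KU F0 x.
    exact: near_eq_derivable (dF _ Ux).
  exact: (derive_near0 _ E).1.
- by rewrite PE; exact: (continuous_patch0 oU cK KU).
- by move=> x nMx; rewrite patchE memNset// => /UM.
Qed.

Lemma is_derive_comp_dir (V : normedModType R) (F : V -> R) (x v : V) (h : R -> R)
    (dF dh : R) :
  is_derive x v F dF -> is_derive (F x) 1 h dh -> is_derive x v (h \o F) (dh * dF).
Proof.
move=> [dvF <-] Hh.
have x0 : x = 0 *: v + x by rewrite scale0r add0r.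
have [e1 e2] := derivable_lineP F x v 0.
have [f1 f2] := derivable_lineP (h \o F) x v 0.
rewrite -x0 in e1 e2 f1 f2.
have D1 : is_derive (0 : R) 1 (fun s : R => F (s *: v + x)) ('D_v F x).
  by split; [exact/e1|rewrite -e2].
rewrite [X in is_derive X](_ : _ = F (0 *: v + x)) in Hh; last by rewrite -x0.
have [d1 d2] := is_derive1_comp Hh D1.
by split; [exact/f1|rewrite f2].
Qed.

(** The time derivative is continuous on the compact set K x [a, b] and vanishes off K at interior
    times, so a constant dominates it on all of U. *)
Lemma is_derive_under_integral n (U K : set 'rV[R]_n) (v : 'rV[R]_n -> R -> R)
    (a b : R) :
  open U -> bounded_set U -> closed K -> K `<=` U ->
  (forall x t, U x -> t \in `[a, b] -> {for x, continuous (v ^~ t)}) ->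
  (forall x t, U x -> t \in `[a, b] -> derivable (v x) t 1) ->
  (forall x t, U x -> t \in `[a, b] ->
     {for (x, t), continuous (fun p : 'rV[R]_n * R => derive1 (v p.1) p.2)}) ->
  (forall x t, U x -> ~ K x -> t \in `[a, b] -> v x t = 0) ->
  forall t, t \in `]a, b[ ->
    is_derive t 1 (fun s => \int[lebesgue_rV n]_(x in U) v x s)
      (\int[lebesgue_rV n]_(x in U) derive1 (v x) t).
Proof.
move=> oU bU cK KU cv dv cdv v0 t tab.
have mU := open_measurable_rV oU.
have bK : bounded_set K.
  move: bU => [M [Mr HM]]; exists M; split=> // y My x Kx.
  by apply: HM => //; exact: KU.
have kK := bounded_closed_compact bK cK.
have [C [_ HC]] : bounded_set ((fun p : 'rV[R]_n * R => derive1 (v p.1) p.2) @`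
    (K `*` `[a, b]%classic)).
  apply: compact_bounded; apply: continuous_compact.
    apply: continuous_in_subspaceT => -[x s]; rewrite inE => -[/= /KU Ux sab].
    exact: cdv.
  by apply: compact_setX => //; exact: segment_compact.
have CC : C < `|C| + 1 by rewrite ltr_pwDr// ler_norm.
have sub s : s \in `]a, b[ -> s \in `[a, b] by exact: subset_itv_oo_cc.
have iv s : s \in `]a, b[ ->
    (lebesgue_rV n).-integrable U (EFin \o (v ^~ s)).
  move=> /sub sab; apply: (integrable_compact_support oU bU cK KU).
    by move=> x Ux; exact: cv.
  by move=> x Ux nKx; exact: v0.
have bd s x : s \in `]a, b[ -> U x -> `|derive1 (v x) s| <= `|C| + 1.
  move=> sab Ux; have [Kx|nKx] := pselect (K x).
    by apply: (HC _ CC); exists (x, s) => //; split => //; exact: sub.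
  rewrite derive1E (derive_near0 _ _).2 ?normr0 ?addr_ge0//.
  have : nbhs s `]a, b[%classic by apply: open_nbhs_nbhs; split => //; exact: interval_open.
  by apply: filterS => r rab; apply: v0 => //; exact: sub.
have iC : (lebesgue_rV n).-integrable U (EFin \o (cst (`|C| + 1))).
  apply: (@integrable_rV_bounded _ _ _ _ (`|C| + 1)) => // x _.
  by rewrite ger0_norm// addr_ge0.
have H1 : forall s, `]a, b[%classic s -> (lebesgue_rV n).-integrable U
   (EFin \o ((fun s x => v x s) s)) by move=> s; exact: iv.
have H2 : forall s x, `]a, b[%classic s -> U x ->
   derivable ((fun s x => v x s) ^~ x) s 1.
  by move=> s x /sub sab Ux; exact: dv.
have C0 (y : 'rV[R]_n) : 0 <= (cst (`|C| + 1) : 'rV[R]_n -> R) y by exact: addr_ge0.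
have H3 : forall s x, `]a, b[%classic s -> U x ->
   `|partial1of2 (fun s x => v x s) s x| <= cst (`|C| + 1) x.
  by move=> s x sab Ux; exact: bd.
split.
  exact: (derivable_under_integral mU tab H1 H2 C0 iC H3).
rewrite -derive1E.
exact: (differentiation_under_integral mU tab H1 H2 C0 iC H3).
Qed.

End compact_support.

(** * A convex cut-off function *)

Section for_continuous.
Context {R : realType} (T : topologicalType).
Implicit Types (f g : T -> R) (x : T).

Lemma for_continuousD f g x : {for x, continuous f} -> {for x, continuous g} ->
  {for x, continuous (fun y => f y + g y)}.
Proof. by move=> cf cg; exact: (@cvgD _ _ _ _ _ _ _ _ _ cf cg). Qed.

Lemma for_continuousM f g x : {for x, continuous f} -> {for x, continuous g} ->
  {for x, continuous (fun y => f y * g y)}.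
Proof. by move=> cf cg; exact: (@cvgM _ _ _ _ _ _ _ _ cf cg). Qed.

Lemma for_continuousN f x : {for x, continuous f} ->
  {for x, continuous (fun y => - f y)}.
Proof. by move=> cf; exact: (@cvgN _ _ _ _ _ _ _ cf). Qed.

Lemma for_continuousB f g x : {for x, continuous f} -> {for x, continuous g} ->
  {for x, continuous (fun y => f y - g y)}.
Proof. by move=> cf cg; exact/for_continuousD/for_continuousN. Qed.

Lemma for_continuous_cst (c : R) x : {for x, continuous (fun _ : T => c)}.
Proof. exact: cvg_cst. Qed.

Lemma for_continuous_comp (S : topologicalType) (h : S -> R) (f : T -> S) x :
  {for x, continuous f} -> {for f x, continuous h} ->
  {for x, continuous (fun y => h (f y))}.
Proof. by move=> cf ch; exact: (@continuous_comp _ _ _ f h). Qed.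

Lemma for_continuous_near f g x : (\forall y \near x, f y = g y) ->
  {for x, continuous f} -> {for x, continuous g}.
Proof.
move=> E cf; have cfx : f @ x --> f x := cf.
rewrite /prop_for/continuous_at -(nbhs_singleton E).
by apply: cvg_trans cfx; apply: near_eq_cvg; exact: E.
Qed.

Lemma for_continuous_sum n (f : 'I_n -> T -> R) x :
  (forall i, {for x, continuous (f i)}) ->
  {for x, continuous (fun y => \sum_(i < n) f i y)}.
Proof.
elim: n f => [|n IH] f cf.
  have -> : (fun y => \sum_(i < 0) f i y) = (fun=> 0).
    by apply/funext => y; rewrite big_ord0.
  exact: for_continuous_cst.
have -> : (fun y => \sum_(i < n.+1) f i y) =
    (fun y => f ord0 y + \sum_(i < n) f (lift ord0 i) y).
  by apply/funext => y; rewrite big_ord_recl.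
by apply: for_continuousD => //; exact: IH.
Qed.

End for_continuous.

Section truncation.
Context {R : realType}.

Definition pospart (s : R) : R := Num.max s 0.

Lemma pospartE s : pospart s = if 0 <= s then s else 0.
Proof. by rewrite /pospart; case: ifPn => [/max_idPl//|]; rewrite -ltNge => /ltW/max_idPr. Qed.

Lemma continuous_pospart : continuous pospart.
Proof. by move=> s; apply: continuous_max => //; exact: cst_continuous. Qed.

Lemma is_derive_pospart2 (s : R) :
  is_derive s 1 (fun s => pospart s ^+ 2) (2 * pospart s).
Proof.
case: (ltgtP s 0) => [s0|s0|->].
- rewrite pospartE leNgt s0/= mulr0.
  apply: (@near_eq_is_derive _ _ _ (cst 0)).
  have : \forall y \near s, y < 0 by exact: lt_nbhsl.
  by apply: filterS => y y0; rewrite pospartE leNgt y0/= expr0n.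
- rewrite pospartE (ltW s0).
  apply: (@near_eq_is_derive _ _ _ (fun y : R => y ^+ 2)).
    have : \forall y \near s, 0 < y by exact: lt_nbhsr.
    by apply: filterS => y y0; rewrite pospartE (ltW y0).
  by apply: is_derive_eq; rewrite /GRing.scale/=; ring.
(* At 0 the difference quotient of the square is [pospart h] itself. *)
- have H : h^-1 *: (((fun s => pospart s ^+ 2) \o shift (0 : R)) (h *: 1)
      - pospart 0 ^+ 2) @[h --> (0 : R)^'] --> 2 * pospart 0.
    have p0 : pospart 0 = 0 by rewrite pospartE lexx.
    rewrite p0 mulr0.
    have : pospart h @[h --> (0 : R)^'] --> (0 : R).
      have := @continuous_pospart 0; rewrite /continuous_at p0.
      exact: cvg_within_filter.
    apply: cvg_trans; apply: near_eq_cvg; near=> h.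
    have h0 : h != 0 by near: h; exact: nbhs_dnbhs_neq.
    rewrite /= addr0 /GRing.scale/= mulr1 expr0n/= subr0 pospartE.
    case: ifPn => _; first by rewrite expr2 mulKf.
    by rewrite expr0n mulr0.
  by split; [apply/cvg_ex; eexists; exact: H|exact: cvg_lim H].
Unshelve. all: end_near. Qed.

Lemma is_derive_pospart3 (s : R) :
  is_derive s 1 (fun s => pospart s ^+ 3) (3 * pospart s ^+ 2).
Proof.
(* In this form the product rule applies, without a second study of the quotient at 0. *)
have -> : (fun s => pospart s ^+ 3) = id * (fun s => pospart s ^+ 2).
  apply/funext => y; rewrite /GRing.mul/= pospartE; case: ifPn => _.
    by rewrite exprS.
  by rewrite !expr0n mulr0.
have D := @is_deriveM _ _ id _ s 1 _ _ (is_derive_id _ _) (is_derive_pospart2 s).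
apply: (is_derive_eq D); rewrite /GRing.scale/= pospartE; case: ifPn => _; ring.
Qed.

Lemma is_derive_subr (f df : R -> R) (a s : R) :
  (forall y : R, is_derive y 1 f (df y)) ->
  is_derive s 1 (fun y : R => f (y - a)) (df (s - a)).
Proof.
move=> H; have D : is_derive s 1 (fun s : R => s - a) 1.
  by apply: is_derive_eq; rewrite subr0.
by have := @is_derive1_comp _ f (fun s => s - a) s _ _ (H (s - a)) D; rewrite mulr1.
Qed.

(* The second difference quotient of [pospart^3/6] at the nodes [e], [2e], [3e]:
   a C^2 convex function that vanishes for [s <= e] and equals [s - 2e] for
   [s >= 3e]; [trunc1] and [trunc2] are its derivatives. *)
Definition trunc0 (e s : R) : R := (6 * e ^+ 2)^-1 *
  (pospart (s - e) ^+ 3 - 2 * pospart (s - 2 * e) ^+ 3 + pospart (s - 3 * e) ^+ 3).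
Definition trunc1 (e s : R) : R := (2 * e ^+ 2)^-1 *
  (pospart (s - e) ^+ 2 - 2 * pospart (s - 2 * e) ^+ 2 + pospart (s - 3 * e) ^+ 2).
Definition trunc2 (e s : R) : R := (e ^+ 2)^-1 *
  (pospart (s - e) - 2 * pospart (s - 2 * e) + pospart (s - 3 * e)).

Lemma is_derive_second_difference (f1 f2 f3 : R -> R) (s c d1 d2 d3 : R) :
  is_derive s 1 f1 d1 -> is_derive s 1 f2 d2 -> is_derive s 1 f3 d3 ->
  is_derive s 1 (fun s => c * (f1 s - 2 * f2 s + f3 s)) (c * (d1 - 2 * d2 + d3)).
Proof.
move=> D1 D2 D3.
have -> : (fun s => c * (f1 s - 2 * f2 s + f3 s)) =
  c \*: (f1 - (2 : R) \*: f2 + f3) by [].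
by apply: is_derive_eq.
Qed.

Lemma is_derive_trunc0 (e s : R) : e != 0 -> is_derive s 1 (trunc0 e) (trunc1 e s).
Proof.
move=> e0.
have D a := @is_derive_subr _ _ a s is_derive_pospart3.
have := is_derive_second_difference (6 * e ^+ 2)^-1 (D e) (D (2 * e)) (D (3 * e)).
by move=> DD; apply: (is_derive_eq DD); rewrite /trunc1; field.
Qed.

Lemma is_derive_trunc1 (e s : R) : e != 0 -> is_derive s 1 (trunc1 e) (trunc2 e s).
Proof.
move=> e0.
have D a := @is_derive_subr _ _ a s is_derive_pospart2.
have := is_derive_second_difference (2 * e ^+ 2)^-1 (D e) (D (2 * e)) (D (3 * e)).
by move=> DD; apply: (is_derive_eq DD); rewrite /trunc2; field.
Qed.

Lemma continuous_trunc0 e : e != 0 -> continuous (trunc0 e).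
Proof. by move=> e0; apply: is_derive1_continuous => s; exact: is_derive_trunc0. Qed.

Lemma continuous_trunc1 e : e != 0 -> continuous (trunc1 e).
Proof. by move=> e0; apply: is_derive1_continuous => s; exact: is_derive_trunc1. Qed.

Lemma continuous_trunc2 e : continuous (trunc2 e).
Proof.
move=> s.
have c a : {for s, continuous (fun s => pospart (s - a))}.
  apply: for_continuous_comp; last exact: continuous_pospart.
  by apply: for_continuousB => //; exact: for_continuous_cst.
apply: (@for_continuousM _ _ (fun=> (e ^+ 2)^-1) (fun s =>
  pospart (s - e) - 2 * pospart (s - 2 * e) + pospart (s - 3 * e))).
  exact: for_continuous_cst.
apply: for_continuousD => //; apply: for_continuousB => //.
by apply: for_continuousM => //; exact: for_continuous_cst.
Qed.

Lemma trunc_small e s : 0 < e -> s <= e ->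
  [/\ trunc0 e s = 0, trunc1 e s = 0 & trunc2 e s = 0].
Proof.
move=> e0 se.
have p0 a : e <= a -> pospart (s - a) = 0.
  by move=> ea; apply/max_idPr; rewrite subr_le0 (le_trans se).
rewrite /trunc0 /trunc1 /trunc2 !p0 ?(mulr0, expr0n, subr0, addr0, mulr0)//=; lra.
Qed.

Lemma trunc2_ge0 e s : 0 < e -> 0 <= trunc2 e s.
Proof.
move=> e0; rewrite mulr_ge0 ?invr_ge0 ?sqr_ge0// !pospartE.
by do ![case: ifPn]; rewrite -?ltNge; lra.
Qed.


Lemma trunc1_bounds e s : 0 < e -> 0 <= trunc1 e s <= 1.
Proof.
move=> e0.
have e2 : 0 < 2 * e ^+ 2 by rewrite mulr_gt0// exprn_gt0.
rewrite /trunc1 mulrC ler_pdivrMr// mul1r; apply/andP; split.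
  apply: divr_ge0; last exact: ltW.
  by rewrite !pospartE; do ![case: ifPn]; rewrite -?ltNge => *; nra.
by rewrite !pospartE; do ![case: ifPn]; rewrite -?ltNge => *; nra.
Qed.

Lemma trunc0_bounds e s : 0 < e -> s - 2 * e <= trunc0 e s <= pospart s.
Proof.
move=> e0; have [se|es] := leP s e.
  have [-> _ _] := trunc_small e0 se; rewrite pospartE.
  by case: ifPn; rewrite -?ltNge => *; lra.
have e2 : 0 < 6 * e ^+ 2 by rewrite mulr_gt0// exprn_gt0.
rewrite /trunc0 [X in _ <= X <= _]mulrC ler_pdivlMr// ler_pdivrMr//.
have pp a : 0 <= a -> pospart a = a by move=> a0; rewrite pospartE a0.
have pn a : a <= 0 -> pospart a = 0 by move=> a0; exact/max_idPr.
rewrite (pp s) ?(pp (s - e)); [|lra|lra].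
have [s2|s2] := leP s (2 * e); [rewrite (pn (s - 2 * e)); last lra|
  rewrite (pp (s - 2 * e)); last lra].
  rewrite (pn (s - 3 * e)); last lra.
  rewrite expr0n/= mulr0 subr0 addr0.
  (* Nonnegative cubic products, chosen so that [nra] can combine them into the two bounds between e
     and 2e. *)
  have h1 : 0 <= (s - e) ^+ 3 by apply: exprn_ge0; lra.
  have h2 : 0 <= (2 * e - s) * (s - e) ^+ 2.
    by apply: mulr_ge0; [lra|exact: sqr_ge0].
  have h3 : 0 <= (2 * e - s) * (s - e) * e.
    by do 2?apply: mulr_ge0; lra.
  have h4 : 0 <= (2 * e - s) * e ^+ 2 by apply: mulr_ge0; [lra|exact: sqr_ge0].
  have h5 : 0 <= (s - e) * e ^+ 2 by apply: mulr_ge0; [lra|exact: sqr_ge0].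
  have h6 : 0 <= e * e ^+ 2 by apply: mulr_ge0; [lra|exact: sqr_ge0].
  by apply/andP; split; nra.
have [s3|s3] := leP s (3 * e); [rewrite (pn (s - 3 * e)); last lra|
  rewrite (pp (s - 3 * e)); last lra].
  rewrite expr0n/= addr0.
  have h1 : 0 <= (3 * e - s) ^+ 3 by apply: exprn_ge0; lra.
  have h2 : 0 <= (s - 2 * e) * (3 * e - s) * e by do 2?apply: mulr_ge0; lra.
  have h3 : 0 <= (s - 2 * e) ^+ 3 by apply: exprn_ge0; lra.
  have h5 : 0 <= (s - 2 * e) * e ^+ 2 by apply: mulr_ge0; [lra|exact: sqr_ge0].
  have h6 : 0 <= e * e ^+ 2 by apply: mulr_ge0; [lra|exact: sqr_ge0].
  by apply/andP; split; nra.
(* Past 3e all three cubes are active and their second difference is affine: the function equals s -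
   2e, so only the slack 12 e^3 in the upper bound needs a sign. *)
have h6 : 0 <= e * e ^+ 2 by apply: mulr_ge0; [lra|exact: sqr_ge0].
by apply/andP; split; nra.
Qed.

Lemma trunc0_ge0 e s : 0 < e -> 0 <= trunc0 e s.
Proof.
move=> e0; have [se|es] := leP s e; first by have [->] := trunc_small e0 se.
have e2 : 0 < 6 * e ^+ 2 by rewrite mulr_gt0// exprn_gt0.
have [s2|s2] := leP s (2 * e); last first.
  by have /andP[+ _] := trunc0_bounds s e0; apply: le_trans; rewrite subr_ge0 ltW.
have pn a : a <= 0 -> pospart a = 0 by move=> a0; exact/max_idPr.
rewrite /trunc0 (pn (s - 2 * e)) ?(pn (s - 3 * e)); [|lra|lra].
rewrite expr0n/= mulr0 subr0 addr0 mulrC divr_ge0// ?ltW// exprn_gt0//.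
by rewrite pospartE; case: ifPn; lra.
Qed.

End truncation.

(** * Green's identity *)

Section green.
Context {R : realType}.

Lemma Rintegral_sum n m (U : set 'rV[R]_n) (f : 'I_m -> 'rV[R]_n -> R) :
  measurable U -> (forall i, (lebesgue_rV n).-integrable U (EFin \o f i)) ->
  \int[lebesgue_rV n]_(x in U) (\sum_(i < m) f i x) =
  \sum_(i < m) \int[lebesgue_rV n]_(x in U) f i x.
Proof.
move=> mU intf; rewrite /Rintegral.
under eq_integral do rewrite -sumEFin.
rewrite integral_sum// (eq_bigr (fun i =>
  (fine (\int[lebesgue_rV n]_(x in U) (f i x)%:E))%:E)) ?sumEFin// => i _.
by rewrite fineK//; apply: integrable_fin_num => //; exact: intf.
Qed.

Lemma partial_cst n (c : R) (i : 'I_n) : partial i (cst c : 'rV[R]_n -> R) = cst 0.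
Proof. by apply/funext => x; rewrite /partial derive_cst. Qed.

Lemma laplacian_cst n (c : R) (x : 'rV[R]_n) : laplacian (cst c) x = 0.
Proof. by rewrite /laplacian big1// => i _; rewrite !partial_cst. Qed.

Lemma C2_on_cst n (U : set 'rV[R]_n) (c : R) : C2_on U (cst c).
Proof.
have dc (d : R) (x v : 'rV[R]_n) : derivable (cst d : 'rV[R]_n -> R) x v by [].
have cc (d : R) (x : 'rV[R]_n) : {for x, continuous (cst d : 'rV[R]_n -> R)}.
  exact: for_continuous_cst.
move=> x _; split; first exact: cc.
  by move=> i; rewrite partial_cst.
by move=> i j; rewrite !partial_cst.
Qed.

(** The integrand is the divergence of the field h0(phi) grad u - u grad (h0(phi)), which vanishes
    off K. With u constant 1 it is minus the Laplacian of h0(phi), the form behind Kato's inequality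
    and the sign of the eigenvalue. *)
Lemma green_identity n (U K : set 'rV[R]_n) (u phi : 'rV[R]_n -> R)
    (h0 h1 h2 : R -> R) :
  open U -> bounded_set U -> closed K -> K `<=` U -> C2_on U u -> C2_on U phi ->
  (forall s : R, is_derive s 1 h0 (h1 s)) ->
  (forall s : R, is_derive s 1 h1 (h2 s)) ->
  continuous h2 ->
  (forall x, U x -> ~ K x -> [/\ h0 (phi x) = 0, h1 (phi x) = 0 & h2 (phi x) = 0]) ->
  \int[lebesgue_rV n]_(x in U) (laplacian u x * h0 (phi x) -
    u x * (h2 (phi x) * (\sum_(i < n) partial i phi x ^+ 2)
           + h1 (phi x) * laplacian phi x)) = 0.
Proof.
move=> oU bU cK KU C2u C2p dh0 dh1 ch2 hK.
have ch0 := is_derive1_continuous dh0.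
have ch1 := is_derive1_continuous dh1.
pose F (i : 'I_n) (x : 'rV[R]_n) :=
  partial i u x * h0 (phi x) - u x * (h1 (phi x) * partial i phi x).
pose P (i : 'I_n) (x : 'rV[R]_n) := partial i (partial i u) x * h0 (phi x) -
  u x * (h2 (phi x) * partial i phi x ^+ 2 + h1 (phi x) * partial i (partial i phi) x).
have FP i x : U x -> is_derive x (delta_mx ord0 i) (F i) (P i x).
  move=> Ux; have [_ du ddu] := C2u _ Ux; have [_ dp ddp] := C2p _ Ux.
  have D1 : is_derive x _ u (partial i u x) := derivableP (du i).1.
  have D2 : is_derive x _ _ (partial i (partial i u) x) := derivableP (ddu i i).1.
  have D3 : is_derive x _ phi (partial i phi x) := derivableP (dp i).1.
  have D4 : is_derive x _ _ (partial i (partial i phi) x) := derivableP (ddp i i).1.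
  have E0 := is_derive_comp_dir D3 (dh0 (phi x)).
  have E1 := is_derive_comp_dir D3 (dh1 (phi x)).
  have T1 := is_deriveM D2 E0.
  have T2 := is_deriveM D1 (is_deriveM E1 D4).
  have T : is_derive x (delta_mx ord0 i) (F i) _ := is_deriveB T1 T2.
  apply: (is_derive_eq T).
  have mulE (f g : 'rV[R]_n -> R) y : (f * g) y = f y * g y by [].
  rewrite mulE /P /GRing.scale/=.
  move: (partial i u x) (partial i (partial i u) x) (partial i phi x)
    (partial i (partial i phi) x) (u x) (h0 (phi x)) (h1 (phi x)) (h2 (phi x)).
  by move=> *; ring.
have cP i x : U x -> {for x, continuous (P i)}.
  move=> Ux; have [cu du ddu] := C2u _ Ux; have [cp dp ddp] := C2p _ Ux.
  have c0 : {for x, continuous (fun x => h0 (phi x))}.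
    by apply: for_continuous_comp => //; exact: ch0.
  have c1 : {for x, continuous (fun x => h1 (phi x))}.
    by apply: for_continuous_comp => //; exact: ch1.
  have c2 : {for x, continuous (fun x => h2 (phi x))}.
    by apply: for_continuous_comp => //; exact: ch2.
  apply: for_continuousB.
    by apply: for_continuousM => //; exact: (ddu i i).2.
  apply: for_continuousM => //; apply: for_continuousD; apply: for_continuousM => //.
    by apply: (@for_continuousM _ _ (partial i phi) (partial i phi)); exact: (dp i).2.
  exact: (ddp i i).2.
have P0 i x : U x -> ~ K x -> P i x = 0.
  by move=> Ux /(hK _ Ux)[e0 e1 e2]; rewrite /P e0 e1 e2 !mul0r addr0 !mulr0 subr0.
have F0 i x : U x -> ~ K x -> F i x = 0.
  by move=> Ux /(hK _ Ux)[e0 e1 e2]; rewrite /F e0 e1 mul0r !mulr0 subr0.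
have PF i x : U x -> partial i (F i) x = P i x.
  by move=> Ux; case: (FP i x Ux).
have mU := open_measurable_rV oU.
transitivity (\int[lebesgue_rV n]_(x in U) (\sum_(i < n) P i x)).
  apply: eq_Rintegral => x _; rewrite /P /laplacian sumrB !mulr_suml; congr (_ - _).
  by rewrite -mulr_sumr big_split/= -!mulr_sumr.
rewrite Rintegral_sum//; last first.
  move=> i; apply: (integrable_compact_support oU bU cK KU).
    by move=> x; exact: cP.
  by move=> x; exact: P0.
rewrite big1// => i _.
transitivity (\int[lebesgue_rV n]_(x in U) partial i (F i) x).
  by apply: eq_Rintegral => x; rewrite inE => Ux; rewrite PF.
apply: (Rintegral_partial_eq0 oU bU cK KU).
- by move=> x Ux; case: (FP i x Ux).
- move=> x Ux; have E : \forall y \near x, P i y = partial i (F i) y.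
    have : nbhs x U by apply: open_nbhs_nbhs.
    by apply: filterS => y Uy; rewrite PF.
  exact: for_continuous_near E (cP i x Ux).
- by move=> x; exact: F0.
Qed.

End green.

(** * Nonnegativity of solutions *)

Section slices.
Context {R : realType}.

Lemma compact_within_le (V : topologicalType) (A : set V) (f : V -> R) (c : R) :
  hausdorff_space V -> compact A -> {within A, continuous f} ->
  compact (A `&` [set x | f x <= c]).
Proof.
move=> hV kA cf; have cA := compact_closed hV kA.
have /closed_subspaceP[W cW WE] : closed ((f : subspace A -> R) @^-1` [set y | y <= c]).
  by move/continuous_closedP : cf; apply; exact: closed_le.
have -> : A `&` [set x | f x <= c] = W `&` A by rewrite WE setIC.
apply: (subclosed_compact _ kA); first exact: closedI.
by move=> x [].
Qed.

(** Leaves room after t, so that t is interior to a compact time interval on which the solution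
    exists. *)
Lemma time_interval_between (T : \bar R) (t : R) : time_interval T t ->
  exists2 b, t < b & time_interval T b.
Proof.
case: T => [r| |] [t0 tT] //.
- rewrite lte_fin in tT; exists ((t + r) / 2); first lra.
  by split; [|rewrite lte_fin]; lra.
- by exists (t + 1); [lra|split; [lra|rewrite ltry]].
Qed.

Lemma time_intervalW (T : \bar R) (s t : R) :
  0 < s -> s <= t -> time_interval T t -> time_interval T s.
Proof. by move=> s0 st [t0 tT]; split => //; apply: le_lt_trans tT; rewrite lee_fin. Qed.

Lemma slice_continuous (V W : topologicalType) (F : V * W -> R) (x : V) (t : W) :
  {for (x, t), continuous F} -> {for x, continuous (fun y => F (y, t))}.
Proof.
move=> cF; apply: (@for_continuous_comp _ _ _ F (fun y => (y, t))) => //.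
by apply: cvg_pair => /=; [exact: cvg_id|exact: cvg_cst].
Qed.

Lemma C21_slice n (Om : set 'rV[R]_n) T u t :
  C21_on Om T u -> time_interval T t -> C2_on Om (u ^~ t).
Proof.
move=> C21 Tt x Omx; have [cu _ du ddu] := C21 x t Omx Tt.
split; first exact: (slice_continuous cu).
- by move=> i; split; [exact: (du i).1|exact: (slice_continuous (du i).2)].
- move=> i j; split; first exact: (ddu i j).1.
  exact: (slice_continuous (ddu i j).2).
Qed.

(** A positive value persists, up to the factor 1/2, on a small box, and such boxes have positive
    measure. *)
Lemma eq0_of_integral_le0 n (U : set 'rV[R]_n) (w : 'rV[R]_n -> R) :
  open U -> (forall x, U x -> {for x, continuous w}) ->
  (forall x, U x -> 0 <= w x) ->
  (\int[lebesgue_rV n]_(x in U) (w x)%:E <= 0)%E -> forall x, U x -> w x = 0.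
Proof.
move=> oU cw w0 iw x Ux; apply/eqP; rewrite eq_le w0// andbT leNgt; apply/negP => wx.
have E : nbhs x (U `&` [set y | w x / 2 < w y]).
  apply: filterI; first exact: open_nbhs_nbhs.
  have : \forall y \near w x, w x / 2 < y by apply: lt_nbhsr; lra.
  exact: cw.
have /nbhs_ballP[r /= r0 Hr] := E.
pose A i : set (measurableTypeR R) := `]x ord0 i - r, x ord0 i + r[%classic.
have mA i : measurable (A i) by exact: measurable_itv.
pose box := [set y : 'rV[R]_n | forall i, A i (rV_coord i y)].
have mbox : measurable box by exact: measurable_rV_box.
have boxU : box `<=` U `&` [set y | w x / 2 < w y].
  move=> y By; apply: Hr; apply/rV_ballP; split=> // i.
  have := By i; rewrite /A/= in_itv/= /rV_coord => /andP[h1 h2].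
  by rewrite ltr_norml; apply/andP; split; lra.
have mw : measurable_fun U (EFin \o w).
  by apply/measurable_EFinP; exact: open_continuous_measurable_rV.
have bpos : (0 < lebesgue_rV n box)%E.
  rewrite /box (lebesgue_rV_box mA); elim/big_ind : _ => //.
  - exact: mule_gt0.
  move=> i _; rewrite /A lebesgue_measure_itv/= lte_fin ifT; last lra.
  by rewrite lte_fin; lra.
have mU := open_measurable_rV oU.
suff : (0 < \int[lebesgue_rV n]_(x in U) (w x)%:E)%E by rewrite ltNge iw.
apply: (@lt_le_trans _ _ ((w x / 2)%:E * lebesgue_rV n box)%E).
  by rewrite mule_gt0// lte_fin divr_gt0.
apply: (@le_trans _ _ (\int[lebesgue_rV n]_(x in box) (w x)%:E)%E).
  rewrite -integral_cst//; apply: ge0_le_integral => //.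
  - by move=> y _; rewrite /= lee_fin divr_ge0// ltW.
  - exact: (measurable_funS mU (fun y By => (boxU y By).1) mw).
  - by move=> y By; rewrite /= lee_fin ltW//; exact: (boxU y By).2.
apply: ge0_subset_integral => //.
by move=> y /boxU[].
Qed.

End slices.

(** * Kato's inequality for the negative part *)

Section kato.
Context {R : realType} (n : nat).
Variables (Om : set 'rV[R]_n) (f : 'rV[R]_n -> R) (g : R -> R) (lam : R)
  (u0 : 'rV[R]_n -> R) (T : \bar R) (u : 'rV[R]_n -> R -> R).
Hypotheses (oOm : open Om) (bOm : bounded_set Om).
Hypothesis f_ge0 : forall x, closure Om x -> 0 <= f x.
Hypothesis g_gt0 : forall s, s < 1 -> 0 < g s.
Hypothesis lam_ge0 : 0 <= lam.
Hypothesis sol : solution Om f g lam u0 T u.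

Lemma compact_closure_domain : compact (closure Om).
Proof.
have [M _ OmM] := bounded_cube bOm.
apply: (subclosed_compact _ (@compact_cube R n M)); first exact: closed_closure.
have cM : closed (@cube R n M).
  by apply: compact_closed; [exact: norm_hausdorff|exact: compact_cube].
by rewrite (closure_id (cube M)).1//; exact: closure_subset.
Qed.

Lemma solution_within (a b : R) : 0 < a -> time_interval T b ->
  {within closure Om `*` `[a, b]%classic, continuous (fun p : 'rV[R]_n * R => u p.1 p.2)}.
Proof.
move=> a0 Tb; apply: continuous_subspaceW (sol_continuous sol).
move=> [x t] [/= clx]; rewrite in_itv/= => /andP[at_ tb]; split=> //=.
by apply: (time_intervalW _ tb) => //; exact: lt_le_trans at_.
Qed.

Lemma compact_space_time (a b : R) : compact (closure Om `*` `[a, b]%classic).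
Proof. by apply: compact_setX; [exact: compact_closure_domain|exact: segment_compact]. Qed.

(** The projection of a compact subset of space-time: one set that works for all times of [a, b].
    For c < 0 it avoids the boundary, where u = 0, and so contains the supports of the truncations
    of u at all these times. *)
Definition sublevel (a b c : R) : set 'rV[R]_n := fst @`
  ((closure Om `*` `[a, b]%classic) `&` [set p | u p.1 p.2 <= c]).

Lemma sublevel_closed a b c : 0 < a -> time_interval T b ->
  closed (sublevel a b c).
Proof.
move=> a0 Tb; apply: compact_closed; first exact: norm_hausdorff.
apply: continuous_compact.
  by apply: continuous_subspaceT => p; exact: cvg_fst.
apply: compact_within_le; first exact: norm_hausdorff.
- exact: compact_space_time.
- exact: solution_within.
Qed.

Lemma sublevel_sub a b c : c < 0 -> 0 < a -> time_interval T b ->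
  sublevel a b c `<=` Om.
Proof.
move=> c0 a0 Tb x [[y t] [[/= cly tab] uc] <-].
apply: contrapT => nOm; move: uc; rewrite (sol_boundary sol) ?leNgt ?c0//.
  by split => // /interior_subset.
move: tab; rewrite in_itv/= => /andP[at_ tb].
by apply: (time_intervalW _ tb) => //; exact: lt_le_trans at_.
Qed.

Lemma sol_lt1_pt x t : closure Om x -> time_interval T t -> u x t < 1.
Proof.
move=> clx Tt; rewrite -lte_fin; apply: le_lt_trans (sol_lt1 sol Tt).
by apply: ereal_sup_ubound; exists (x, t) => //; split => //=; case: Tt => -> _ /=.
Qed.

Lemma nbhs_cylinder x t : Om x -> time_interval T t ->
  nbhs (x, t) (Om `*` time_interval T).
Proof.
move=> Omx Tt; exists (Om, time_interval T) => //; split => /=.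
  exact: open_nbhs_nbhs.
have [b tb [_ bT]] := time_interval_between Tt.
have : nbhs t `]0, b[%classic.
  apply: open_nbhs_nbhs; split; first exact: interval_open.
  by rewrite /= in_itv/= tb andbT; case: Tt.
apply: filterS => s; rewrite /= in_itv/= => /andP[s0 sb]; split => //.
by apply: lt_trans bT; rewrite lte_fin.
Qed.

(* Kato: by Green's identity [\int h'(u) Delta u = - \int h''(u) |grad u|^2 <= 0]
   for the convex function h = trunc0 e (- s), whose composition with u vanishes
   near the lateral boundary. *)
Lemma kato_nonincreasing e t1 t2 : 0 < e -> 0 < t1 -> t1 <= t2 ->
  time_interval T t2 ->
  \int[lebesgue_rV n]_(x in Om) trunc0 e (- u x t2) <=
  \int[lebesgue_rV n]_(x in Om) trunc0 e (- u x t1).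
Proof.
move=> e0 t10 t12 Tt2.
have en0 : e != 0 by rewrite gt_eqF.
have [b t2b Tb] := time_interval_between Tt2.
(* Together with b > t2 this puts [t1, t2] inside the open interval on which the integral is
   differentiable. *)
pose a := t1 / 2.
have a0 : 0 < a by rewrite divr_gt0.
have at1 : a < t1 by rewrite /a; lra.
have Tab t : t \in `[a, b] -> time_interval T t.
  rewrite in_itv/= => /andP[at_ tb].
  by apply: (time_intervalW _ tb) => //; exact: lt_le_trans at_.
pose K := sublevel a b (- e).
have cK : closed K by exact: sublevel_closed.
have KU : K `<=` Om by apply: sublevel_sub => //; rewrite oppr_lt0.
have outK x t : Om x -> ~ K x -> t \in `[a, b] -> - u x t <= e.
  move=> Omx nKx tab; rewrite leNgt; apply/negP => h; apply: nKx.
  exists (x, t) => //; split; first by split => //; exact: subset_closure.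
  by rewrite /=; lra.
pose h0 s := trunc0 e (- s); pose h1 s := - trunc1 e (- s); pose h2 s := trunc2 e (- s).
have dN (s : R) : is_derive s 1 (fun s : R => - s) (- 1) by apply: is_derive_eq.
have dh0 (s : R) : is_derive s 1 h0 (h1 s).
  have := @is_derive1_comp _ (trunc0 e) (fun s => - s) s _ _ (is_derive_trunc0 _ en0) (dN s).
  by rewrite mulrN1.
have dh1 (s : R) : is_derive s 1 h1 (h2 s).
  have D := @is_derive1_comp _ (trunc1 e) (fun s => - s) s _ _ (is_derive_trunc1 _ en0) (dN s).
  by have := is_deriveN D; rewrite mulrN1 opprK.
have ch2 : continuous h2.
  move=> s; apply: (@for_continuous_comp _ _ _ (trunc2 e) (fun s => - s)).
    exact: opp_continuous.
  exact: continuous_trunc2.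
have ch1 := is_derive1_continuous dh1.
have ch0 := is_derive1_continuous dh0.
have hK x t : Om x -> ~ K x -> t \in `[a, b] ->
    [/\ h0 (u x t) = 0, h1 (u x t) = 0 & h2 (u x t) = 0].
  move=> Omx nKx tab; rewrite /h0 /h1 /h2.
  by have [-> -> ->] := trunc_small e0 (outK _ _ Omx nKx tab); rewrite oppr0.
pose v x t := h0 (u x t).
have dv x t : Om x -> time_interval T t ->
    is_derive t 1 (v x) (h1 (u x t) * derive1 (u x) t).
  move=> Omx Tt; have [_ [du _] _ _] := sol_C21 sol Omx Tt.
  have D : is_derive t 1 (u x) (derive1 (u x) t) by rewrite derive1E; exact: derivableP.
  exact: (is_derive1_comp (dh0 _) D).
have dvE x t : Om x -> time_interval T t ->
    derive1 (v x) t = h1 (u x t) * derive1 (u x) t.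
  by move=> Omx tab; rewrite derive1E; case: (dv _ _ Omx tab).
have cdv x t : Om x -> time_interval T t ->
    {for (x, t), continuous (fun p : 'rV[R]_n * R => derive1 (v p.1) p.2)}.
  move=> Omx Tt; have [cu [_ cdu] _ _] := sol_C21 sol Omx Tt.
  apply: (@for_continuous_near _ _
    (fun p : 'rV[R]_n * R => h1 (u p.1 p.2) * derive1 (u p.1) p.2)).
    by apply: filterS (nbhs_cylinder Omx Tt) => -[y s] [/= Omy Ts]; rewrite dvE.
  apply: for_continuousM => //.
  by apply: (for_continuous_comp cu); exact: ch1.
have cv x t : Om x -> time_interval T t -> {for x, continuous (v ^~ t)}.
  move=> Omx Tt; have [cu _ _ _] := sol_C21 sol Omx Tt.
  apply: (@for_continuous_comp _ _ _ h0 (u ^~ t)); last exact: ch0.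
  exact: (slice_continuous cu).
pose M t := \int[lebesgue_rV n]_(x in Om) v x t.
have dM : forall t, t \in `]a, b[ -> is_derive t 1 M
    (\int[lebesgue_rV n]_(x in Om) derive1 (v x) t).
  apply: (is_derive_under_integral oOm bOm cK KU).
  - by move=> x t Omx /Tab; exact: cv.
  - by move=> x t Omx /Tab Tt; case: (dv _ _ Omx Tt).
  - by move=> x t Omx /Tab; exact: cdv.
  - by move=> x t Omx nKx tab; case: (hK x t Omx nKx tab).
have oc t : t \in `]a, b[ -> t \in `[a, b] by exact: subset_itv_oo_cc.
have dM0 t : t \in `]a, b[ -> derive1 M t <= 0.
  move=> tab; have Tt := Tab _ (oc _ tab).
  rewrite derive1E; case: (dM t tab) => _ ->.
  have C2u := C21_slice (sol_C21 sol) Tt.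
  (* Here u is the function composed with the truncation and the other factor is constant: the
     Laplacian of h(u) integrates to 0. *)
  have G := green_identity oOm bOm cK KU (C2_on_cst 1) C2u dh0 dh1 ch2
    (fun x Omx nKx => hK x t Omx nKx (oc _ tab)).
  pose w x := h2 (u x t) * (\sum_(i < n) partial i (u ^~ t) x ^+ 2)
    + h1 (u x t) * laplacian (u ^~ t) x.
  have iw : (lebesgue_rV n).-integrable Om (EFin \o w).
    apply: (integrable_compact_support oOm bOm cK KU).
      move=> x Omx; have [cu du ddu] := C2u x Omx.
      apply: for_continuousD; apply: for_continuousM.
      + by apply: (for_continuous_comp cu); exact: ch2.
      + apply: for_continuous_sum => i.
        by apply: (@for_continuousM _ _ (partial i (u ^~ t)) (partial i (u ^~ t)));
          exact: (du i).2.
      + by apply: (for_continuous_comp cu); exact: ch1.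
      + by apply: for_continuous_sum => i; exact: (ddu i i).2.
    move=> x Omx nKx; rewrite /w.
    by have [_ -> ->] := hK _ _ Omx nKx (oc _ tab); rewrite !mul0r addr0.
  have Gw : \int[lebesgue_rV n]_(x in Om) w x = 0.
    apply: oppr_inj; rewrite oppr0 -[RHS]G -mulN1r -RintegralZl//.
      by apply: eq_Rintegral => x _; rewrite laplacian_cst -/(w x) mul0r sub0r mul1r mulN1r.
    exact: open_measurable_rV.
  rewrite -Gw; apply: le_Rintegral.
  - exact: open_measurable_rV.
  - apply: (integrable_compact_support oOm bOm cK KU).
      by move=> x Omx; have := slice_continuous (cdv x t Omx Tt).
    move=> x Omx nKx; rewrite dvE//.
    by have [_ -> _] := hK _ _ Omx nKx (oc _ tab); rewrite mul0r.
  - exact: iw.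
  (* By the equation h'(u) u_t = h'(u) Delta u + h'(u) lam f / g(u). The last term is nonpositive
     since h' <= 0, and the term h''(u) |grad u|^2 that completes the Laplacian of h(u) is
     nonnegative. *)
  - move=> x Omx; rewrite dvE// (sol_equation sol Omx Tt) /w.
    have ? : 0 <= h2 (u x t) by exact: trunc2_ge0.
    have ? : h1 (u x t) <= 0.
      by rewrite oppr_le0; have /andP[] := trunc1_bounds (- u x t) e0.
    have ? : 0 <= \sum_(i < n) partial i (u ^~ t) x ^+ 2.
      by apply: sumr_ge0 => i _; exact: sqr_ge0.
    have clx := subset_closure Omx.
    have ? : 0 <= lam * (f x / g (u x t)).
      rewrite mulr_ge0// divr_ge0 ?f_ge0// ltW// g_gt0//; exact: sol_lt1_pt.
    nra.
have cM : {within `[t1, t2], continuous M}.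
  apply: derivable_within_continuous => t; rewrite in_itv/= => /andP[h1t h2t].
  by case: (dM t) => //; rewrite in_itv/=; apply/andP; split; lra.
apply: (@ler0_derive1_nincr _ M t1 t2) => //.
- move=> t; rewrite in_itv/= => /andP[h1t h2t].
  by case: (dM t) => //; rewrite in_itv/=; apply/andP; split; lra.
- move=> t; rewrite in_itv/= => /andP[h1t h2t].
  by apply: dM0; rewrite in_itv/=; apply/andP; split; lra.
Qed.

Lemma integrable_trunc_neg e t : 0 < e -> time_interval T t ->
  (lebesgue_rV n).-integrable Om (EFin \o (fun x => trunc0 e (- u x t))).
Proof.
move=> e0 Tt; have t0 : 0 < t by case: Tt.
have ct0 := continuous_trunc0 (lt0r_neq0 e0).
apply: (@integrable_compact_support _ _ _ (sublevel t t (- e))) => //.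
- exact: sublevel_closed.
- by apply: sublevel_sub => //; rewrite oppr_lt0.
- move=> x Omx; apply: (@for_continuous_comp _ _ _ (trunc0 e)); last exact: ct0.
  have [cu _ _ _] := sol_C21 sol Omx Tt.
  by apply: for_continuousN; exact: (slice_continuous cu).
- move=> x Omx nKx; suff ue : - u x t <= e by have [-> _ _] := trunc_small e0 ue.
  rewrite leNgt; apply/negP => h; apply: nKx; exists (x, t) => //; split.
    by split; [exact: subset_closure|rewrite /= in_itv/= lexx].
  by rewrite /=; lra.
Qed.

Hypothesis u0_int : (lebesgue_rV n).-integrable Om (EFin \o u0).
Hypothesis u0_ge0 : {ae lebesgue_rV n, forall x, Om x -> 0 <= u0 x}.

Lemma solution_measurable t : time_interval T t -> measurable_fun Om (u ^~ t).
Proof.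
move=> Tt; apply: open_continuous_measurable_rV => // x Omx.
by have [cu _ _ _] := sol_C21 sol Omx Tt; exact: (slice_continuous cu).
Qed.

(** At small times the integral of the truncated negative part is at most the L^1 distance from u to
    u0, because u0 >= 0; as it does not increase in time, it is 0. Then e tends to 0. *)
Lemma solution_ge0 x t : Om x -> time_interval T t -> 0 <= u x t.
Proof.
move=> Omx Tt; have mOm := open_measurable_rV oOm.
have ct0 e : 0 < e -> continuous (trunc0 e).
  by move=> e0; exact: continuous_trunc0 (lt0r_neq0 e0).
have mu0 : measurable_fun Om u0.
  by apply/measurable_EFinP; move/integrableP : u0_int => [].
suff H e : 0 < e -> trunc0 e (- u x t) = 0.
  apply/ler_addgt0Pl => e e0.
  have e20 : 0 < e / 2 by rewrite divr_gt0.
  by have /andP[+ _] := trunc0_bounds (- u x t) e20; rewrite H//; lra.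
move=> e0; move: x Omx.
apply: (@eq0_of_integral_le0 _ _ _ (fun x => trunc0 e (- u x t))) => //.
- move=> x Omx; apply: (@for_continuous_comp _ _ _ (trunc0 e)); last exact: ct0.
  have [cu _ _ _] := sol_C21 sol Omx Tt.
  by apply: for_continuousN; exact: (slice_continuous cu).
- by move=> x _; exact: trunc0_ge0.
have fI s : time_interval T s ->
    (\int[lebesgue_rV n]_(x in Om) (trunc0 e (- u x s))%:E =
     (\int[lebesgue_rV n]_(x in Om) trunc0 e (- u x s))%:E)%E.
  move=> Ts; rewrite /Rintegral fineK//; apply: integrable_fin_num => //.
  exact: integrable_trunc_neg.
rewrite fI// lee_fin; apply/ler_addgt0Pl => eta eta0; rewrite addr0.
have ev : \forall s \near 0^'+,
    (\int[lebesgue_rV n]_(x in Om) `|u x s - u0 x|%:E < eta%:E)%E.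
  have : \forall y \near (0%E : \bar R), (y < eta%:E)%E.
    exact: lt_nbhsl.
  exact: (sol_initial sol).
have t0 : 0 < t by case: Tt.
have [s [s0 st Hs]] : exists s, [/\ 0 < s, s <= t &
    (\int[lebesgue_rV n]_(x in Om) `|u x s - u0 x|%:E < eta%:E)%E].
  near (0 : R)^'+ => s; exists s; split.
  - by near: s; exact: nbhs_right_gt.
  - by near: s; exact: nbhs_right_le.
  - by near: s; exact: ev.
have Ts := time_intervalW s0 st Tt.
apply: (le_trans (kato_nonincreasing e0 s0 st Tt)).
rewrite -lee_fin -fI//; apply: le_trans (ltW Hs).
apply: ae_ge0_le_integral => //.
- by move=> x _; rewrite lee_fin trunc0_ge0.
- by have /integrableP[] := integrable_trunc_neg e0 Ts.
- apply/measurable_EFinP; apply: measurableT_comp => //.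
  by apply: measurable_funB => //; exact: solution_measurable.
apply: filterS u0_ge0 => x Hx Omx; rewrite lee_fin.
have /andP[_ h] := trunc0_bounds (- u x s) e0; apply: (le_trans h).
rewrite pospartE; case: ifPn => // _.
have := Hx Omx; have := ler_norm (- (u x s - u0 x)); rewrite normrN; lra.
Unshelve. all: end_near. Qed.

End kato.

(** * The convex function [1/g] *)

Section reciprocal.
Context {R : realType} (g : R -> R).
Hypotheses (C2g : C2_lt1 g) (g_gt0 : forall s, s < 1 -> 0 < g s).
Hypothesis dg_le0 : forall s, s < 1 -> derive1 g s <= 0.
Hypothesis ddG_ge0 : forall s, s < 1 -> 0 <= derive1n 2 (fun y => (g y)^-1) s.

Let G s := (g s)^-1.

Lemma nbhs_lt1 (s : R) : s < 1 -> \forall y \near s, y < 1.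
Proof. exact: lt_nbhsl. Qed.

Lemma derivable_g (s : R) : s < 1 -> derivable g s 1.
Proof. by move=> s1; have [dg _ _] := C2g s1; exact: dg. Qed.

Lemma is_derive_g (s : R) : s < 1 -> is_derive s 1 g (derive1 g s).
Proof. by move=> s1; rewrite derive1E; exact/derivableP/derivable_g. Qed.

Lemma continuous_g s : s < 1 -> {for s, continuous g}.
Proof. by move=> s1; exact/differentiable_continuous/derivable1_diffP/derivable_g. Qed.

Lemma g_nonincreasing x y : x <= y -> y < 1 -> g y <= g x.
Proof.
move=> xy y1; have lt1 t : t <= y -> t < 1 by move=> ty; exact: le_lt_trans y1.
apply: (@ler0_derive1_nincr _ g x y) => //.
- by move=> t; rewrite in_itv/= => /andP[_ /ltW/lt1]; exact: derivable_g.
- by move=> t; rewrite in_itv/= => /andP[_ /ltW/lt1]; exact: dg_le0.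
- apply: derivable_within_continuous => t; rewrite in_itv/= => /andP[_ /lt1].
  exact: derivable_g.
Qed.

Lemma G_nondecreasing x y : x <= y -> y < 1 -> G x <= G y.
Proof.
move=> xy y1; rewrite /G lef_pV2 ?posrE ?g_gt0//; last exact: le_lt_trans y1.
exact: g_nonincreasing.
Qed.

Lemma is_derive_G (s : R) : s < 1 -> is_derive s 1 G (- derive1 g s * (G s * G s)).
Proof.
move=> s1; have g0 : g s != 0 by rewrite gt_eqF// g_gt0.
have D := is_deriveV g0 (is_derive_g s1).
by apply: (is_derive_eq D); rewrite /GRing.scale/= /G expr2 invfM; ring.
Qed.

Lemma derive1_GE s : s < 1 -> derive1 G s = - derive1 g s * (G s * G s).
Proof. by move=> /is_derive_G[_ <-]; rewrite derive1E. Qed.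

Lemma derive1_G_ge0 s : s < 1 -> 0 <= derive1 G s.
Proof.
move=> s1; rewrite derive1_GE// mulr_ge0 ?oppr_ge0 ?dg_le0//.
by rewrite -expr2 sqr_ge0.
Qed.

Lemma derivable_derive1_G (s : R) : s < 1 -> derivable (derive1 G) s 1.
Proof.
move=> s1; have [_ ddg _] := C2g s1; have [dG _] := is_derive_G s1.
apply: (@near_eq_derivable _ _ _ ((- derive1 g) * (G * G))).
  by apply: filterS (nbhs_lt1 s1) => y y1; rewrite derive1_GE.
exact: (derivableM (derivableN ddg) (derivableM dG dG)).
Qed.

Lemma derive1_G_nondecreasing x y : x <= y -> y < 1 -> derive1 G x <= derive1 G y.
Proof.
move=> xy y1; have lt1 t : t <= y -> t < 1 by move=> ty; exact: le_lt_trans y1.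
apply: (@ger0_derive1_ndecr _ (derive1 G) x y) => //.
- by move=> t; rewrite in_itv/= => /andP[_ /ltW/lt1]; exact: derivable_derive1_G.
- by move=> t; rewrite in_itv/= => /andP[_ /ltW/lt1]; exact: ddG_ge0.
- apply: derivable_within_continuous => t; rewrite in_itv/= => /andP[_ /lt1].
  exact: derivable_derive1_G.
Qed.

(** The mean value theorem yields the slope of a chord, which the monotone derivative compares with
    the slope at [s0], on either side. Integrated against the probability density phi, this is
    Jensen's inequality. *)
Lemma G_tangent s0 s : s0 < 1 -> s < 1 -> G s0 + derive1 G s0 * (s - s0) <= G s.
Proof.
move=> s01 s1.
have dG (t : R) : t < 1 -> is_derive t 1 G (derive1 G t).
  by move=> t1; rewrite derive1_GE//; exact: is_derive_G.
have cG x y : y < 1 -> {within `[x, y], continuous G}.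
  move=> y1; apply: derivable_within_continuous => t; rewrite in_itv/= => /andP[_ ty].
  by case: (dG t (le_lt_trans ty y1)).
case: (ltgtP s s0) => [lt|lt|->]; last by rewrite subrr mulr0 addr0.
  have dG' (x : R) : x \in `]s, s0[ -> is_derive x 1 G (derive1 G x).
    by rewrite in_itv/= => /andP[_ xs]; apply: dG; exact: lt_trans s01.
  have [c] := MVT lt dG' (cG _ _ s01).
  rewrite in_itv/= => /andP[_ cs0] E.
  have := derive1_G_nondecreasing (ltW cs0) s01; nra.
have dG' (x : R) : x \in `]s0, s[ -> is_derive x 1 G (derive1 G x).
  by rewrite in_itv/= => /andP[_ xs]; apply: dG; exact: lt_trans s1.
have [c] := MVT lt dG' (cG _ _ s1).
rewrite in_itv/= => /andP[s0c cs] E.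
have := derive1_G_nondecreasing (ltW s0c) (lt_trans cs s1); nra.
Qed.

End reciprocal.

(** * The first eigenfunction *)

Section eigenfunction.
Context {R : realType} (n : nat).
Variables (B : set 'rV[R]_n) (mu : R) (phi : 'rV[R]_n -> R).
Hypotheses (oB : open B) (bB : bounded_set B).
Hypothesis eig : dirichlet_eigenfunction B mu phi.
Hypothesis phi_gt0 : forall x, B x -> 0 < phi x.

Lemma phi_continuous x : B x -> {for x, continuous phi}.
Proof. by case: eig => C2p _ _ _ _ /C2p[]. Qed.

Lemma phi_bounded : exists2 M, 0 <= M & forall x, B x -> phi x <= M.
Proof.
have [_ cphi _ _ _] := eig.
have [M [_ HM]] := compact_bounded (continuous_compact cphi (compact_closure_domain bB)).
have MM : M < `|M| + 1 by rewrite ltr_pwDr// ler_norm.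
exists (`|M| + 1); first by rewrite addr_ge0.
move=> x Bx; apply: (le_trans (ler_norm _)).
by apply: (HM _ MM); exists x => //; exact: subset_closure.
Qed.

(** The set where phi >= e, off which h(phi) vanishes; both signs are reversed to match
    [compact_within_le]. *)
Definition superlevel (e : R) : set 'rV[R]_n :=
  closure B `&` [set x | - phi x <= - e].

Lemma superlevel_closed e : closed (superlevel e).
Proof.
have [_ cphi _ _ _] := eig.
apply: compact_closed; first exact: norm_hausdorff.
apply: compact_within_le; [exact: norm_hausdorff|exact: compact_closure_domain|].
by move=> x; apply: cvgN; exact: cphi.
Qed.

Lemma superlevel_sub e : 0 < e -> superlevel e `<=` B.
Proof.
move=> e0 x [clx /=]; rewrite lerN2 => ephi.
apply: contrapT => nB; have [_ _ _ phi0 _] := eig.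
move: ephi; rewrite phi0 ?leNgt ?e0//.
by split => // /interior_subset.
Qed.

Lemma superlevel_out e x : B x -> ~ superlevel e x -> phi x <= e.
Proof.
move=> Bx nK; rewrite leNgt; apply/negP => h; apply: nK; split.
  exact: subset_closure.
by rewrite /= lerN2 ltW.
Qed.

(* [\int h'(phi) (mu phi) = \int h''(phi) |grad phi|^2 >= 0] for a convex cut-off h. *)
Lemma dirichlet_eigenvalue_ge0 : 0 <= mu.
Proof.
have [C2p _ eqp _ [x Bx _]] := eig.
rewrite leNgt; apply/negP => mu0.
(* The value phi x = 4e then lies past the last node 3e, where the cut-off has derivative 1. If mu <
   0, the integrand [w] is positive at x, although it is nonnegative with integral 0. *)
pose e := phi x / 4.
have px := phi_gt0 Bx.
have e0 : 0 < e by rewrite divr_gt0.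
have en0 := lt0r_neq0 e0.
have d0 s := is_derive_trunc0 s en0.
have d1 s := is_derive_trunc1 s en0.
have out y : B y -> ~ superlevel e y ->
    [/\ trunc0 e (phi y) = 0, trunc1 e (phi y) = 0 & trunc2 e (phi y) = 0].
  by move=> By nK; apply: trunc_small => //; exact: superlevel_out.
have G := green_identity oB bB (@superlevel_closed e) (superlevel_sub e0)
  (C2_on_cst 1) C2p d0 d1 (@continuous_trunc2 _ e) out.
pose w y := trunc2 e (phi y) * (\sum_(i < n) partial i phi y ^+ 2)
  + trunc1 e (phi y) * laplacian phi y.
have w0 y : B y -> 0 <= w y.
  move=> By; rewrite /w.
  have /andP[h1 _] := trunc1_bounds (phi y) e0.
  rewrite addr_ge0// mulr_ge0// ?trunc2_ge0//.
    by apply: sumr_ge0 => i _; exact: sqr_ge0.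
  by rewrite -[laplacian _ _]opprK eqp// oppr_ge0 nmulr_rle0// ltW// phi_gt0.
have cw y : B y -> {for y, continuous w}.
  move=> By; have [cp dp ddp] := C2p y By.
  apply: for_continuousD; apply: for_continuousM.
  - by apply: (for_continuous_comp cp); exact: continuous_trunc2.
  - apply: for_continuous_sum => i.
    by apply: (@for_continuousM _ _ (partial i phi) (partial i phi)); exact: (dp i).2.
  - apply: (for_continuous_comp cp).
    exact: continuous_trunc1.
  - by apply: for_continuous_sum => i; exact: (ddp i i).2.
have iw : (lebesgue_rV n).-integrable B (EFin \o w).
  apply: (integrable_compact_support oB bB (@superlevel_closed e) (superlevel_sub e0) cw).
  by move=> y By nK; rewrite /w; have [_ -> ->] := out y By nK; rewrite !mul0r addr0.
have mB := open_measurable_rV oB.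
have Gw : \int[lebesgue_rV n]_(x in B) w x = 0.
  apply: oppr_inj; rewrite oppr0 -[RHS]G -mulN1r -RintegralZl//.
  by apply: eq_Rintegral => y _; rewrite laplacian_cst -/(w y) mul0r sub0r mul1r mulN1r.
have : w x = 0.
  apply: (eq0_of_integral_le0 oB cw w0) => //.
  by rewrite -(@fineK _ (\int[lebesgue_rV n]_(x in B) (w x)%:E)%E)
    ?integrable_fin_num// -/(Rintegral _ _ _) Gw.
have t1 : trunc1 e (phi x) = 1.
  have -> : phi x = 4 * e by rewrite /e; field.
  rewrite /trunc1 !pospartE !ifT; [|lra..].
  by field.
have t2 : 0 <= trunc2 e (phi x) * (\sum_(i < n) partial i phi x ^+ 2).
  rewrite mulr_ge0// ?trunc2_ge0//; apply: sumr_ge0 => i _; exact: sqr_ge0.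
have : 0 < laplacian phi x.
  by rewrite -[laplacian _ _]opprK eqp// oppr_gt0 nmulr_rlt0.
by rewrite /w t1 mul1r; lra.
Qed.

End eigenfunction.

(** * The energy inequality *)

(** The comparison under the integral, on abstract reals so that [lra] treats the products as atoms:
    [L] is Delta u, [h] and [h1] are h(phi) and h'(phi), [S] is h''(phi) |grad phi|^2, [U] is u, [p]
    is phi, [ld] is lam delta, [k] the slope of the tangent, [F] the reaction term. *)
Lemma density_bound (R : realFieldType)
    (L h h1 S U p mu ld k G0 s0 Gm e F : R) :
  0 <= U * S -> U * (h1 * (mu * p)) <= mu * (U * p) ->
  ld * ((G0 + k * (U - s0)) * p - 2 * e * Gm) <= F * h ->
  L * h - U * (S + h1 * - (mu * p)) +
    ((- mu + ld * k) * (U * p) + (ld * (G0 - k * s0) * p + - (2 * ld * Gm * e) * 1))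
  <= (L + F) * h.
Proof. lra. Qed.

Section energy.
Context {R : realType} (n : nat).
Variables (Om B : set 'rV[R]_n) (f : 'rV[R]_n -> R) (g : R -> R) (lam mu delta : R)
  (phi u0 : 'rV[R]_n -> R) (T : \bar R) (u : 'rV[R]_n -> R -> R).
Hypotheses (oOm : open Om) (bOm : bounded_set Om) (oB : open B) (BOm : B `<=` Om).
Hypothesis f_ge0 : forall x, closure Om x -> 0 <= f x.
Hypotheses (delta_gt0 : 0 < delta) (f_delta : forall x, B x -> delta <= f x).
Hypotheses (C2g : C2_lt1 g) (g_gt0 : forall s, s < 1 -> 0 < g s).
Hypothesis dg_le0 : forall s, s < 1 -> derive1 g s <= 0.
Hypothesis ddG_ge0 : forall s, s < 1 -> 0 <= derive1n 2 (fun y => (g y)^-1) s.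
Hypothesis eig : dirichlet_eigenfunction B mu phi.
Hypothesis phi_gt0 : forall x, B x -> 0 < phi x.
Hypothesis phi_int1 : \int[lebesgue_rV n]_(x in B) phi x = 1.
Hypothesis lam_ge0 : 0 <= lam.
Hypothesis u0_init : initial_datum Om u0.
Hypothesis u0_ge0 : {ae lebesgue_rV n, forall x, Om x -> 0 <= u0 x}.
Hypothesis sol : solution Om f g lam u0 T u.

Let G s := (g s)^-1.
Let E t := \int[lebesgue_rV n]_(x in B) (u x t * phi x).

Let bB : bounded_set B.
Proof.
move: bOm => [M [Mr HM]]; exists M; split=> // y My x Bx.
by apply: HM => //; exact: BOm.
Qed.

Let mB : measurable B. Proof. exact: open_measurable_rV. Qed.

Let u_ge0 x t : B x -> time_interval T t -> 0 <= u x t.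
Proof.
move=> Bx Tt; case: u0_init => u0_int _.
exact: (solution_ge0 oOm bOm f_ge0 g_gt0 lam_ge0 sol u0_int u0_ge0 (BOm Bx) Tt).
Qed.

Let u_lt1 x t : B x -> time_interval T t -> u x t < 1.
Proof. by move=> Bx; apply: (sol_lt1_pt sol); exact/subset_closure/BOm. Qed.

Let mphi : measurable_fun B phi.
Proof.
by apply: open_continuous_measurable_rV => // x; exact: (phi_continuous eig).
Qed.

Let iphi : (lebesgue_rV n).-integrable B (EFin \o phi).
Proof.
have [M _ HM] := phi_bounded bB eig.
apply: (integrable_rV_bounded bB mB mphi (C := M)) => x Bx.
by rewrite ger0_norm ?HM// ltW// phi_gt0.
Qed.

Let ione : (lebesgue_rV n).-integrable B (EFin \o cst (1 : R)).
Proof.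
by apply: (integrable_rV_bounded bB mB (C := 1)) => // x _; rewrite /= normr1.
Qed.

Let iuphi t : time_interval T t ->
  (lebesgue_rV n).-integrable B (EFin \o (fun x => u x t * phi x)).
Proof.
move=> Tt; have [M M0 HM] := phi_bounded bB eig.
apply: (integrable_rV_bounded bB mB (C := M)) => [|x Bx].
  apply: measurable_funM => //.
  apply: (measurable_funS (open_measurable_rV oOm) BOm).
  exact: (solution_measurable oOm sol).
have := HM _ Bx; have := phi_gt0 Bx; have := u_ge0 Bx Tt; have := u_lt1 Bx Tt.
by move=> *; rewrite ger0_norm; nra.
Qed.

Lemma solution_uniform_lt1 b : time_interval T b ->
  exists2 m, m < 1 & forall x t, B x -> 0 < t -> t <= b -> u x t <= m.
Proof.
move=> Tb; have := sol_lt1 sol Tb; set S := ereal_sup _ => S1.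
have Sub x t : B x -> 0 < t -> t <= b -> ((u x t)%:E <= S)%E.
  move=> Bx t0 tb; apply: ereal_sup_ubound; exists (x, t) => //; split => /=.
    exact/subset_closure/BOm.
  by rewrite t0.
case: S S1 Sub => [s| |] // S1 Sub.
  by exists s => // x t Bx t0 tb; rewrite -lee_fin; exact: Sub.
(* The supremum is [-oo] only over an empty set, so the value 0 is arbitrary. *)
exists 0 => // x t Bx t0 tb.
by have := Sub x t Bx t0 tb; rewrite leeNy_eq.
Qed.

Lemma energy_bounds t : time_interval T t -> 0 <= E t < 1.
Proof.
move=> Tt; apply/andP; split.
  by apply: Rintegral_ge0 => x Bx; rewrite mulr_ge0 ?u_ge0// ltW// phi_gt0.
have [m m1 Hm] := solution_uniform_lt1 Tt.
apply: (@le_lt_trans _ _ m) => //; rewrite -[m]mulr1 -[X in m * X]phi_int1.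
rewrite -RintegralZl//; apply: le_Rintegral => //.
- exact: iuphi.
- by have := integrableZl mB m iphi.
- move=> x Bx; rewrite ler_wpM2r ?(ltW (phi_gt0 Bx))// Hm//.
  by case: Tt.
Qed.

Let V := \int[lebesgue_rV n]_(x in B) (1 : R).

(** [y] is the integral of u h(phi). The constant depends on b, through the bound m < 1 for u, but
    not on e. One [y] serves all tangent points [s0], so [s0] may be chosen afterwards and may vary
    with t. *)
Lemma energy_inequality b : time_interval T b ->
  exists2 C, 0 <= C & forall e, 0 < e -> exists y : R -> R,
  forall t, 0 < t -> t <= b ->
  [/\ 0 <= y t, y t <= E t, E t <= y t + C * e &
    exists2 dy : R, is_derive t 1 y dy & forall s0, s0 < 1 ->
      - mu * E t + lam * delta * (G s0 + derive1 G s0 * (E t - s0)) - C * e <= dy].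
Proof.
move=> Tb.
have mu_ge0 := dirichlet_eigenvalue_ge0 oB bB eig phi_gt0.
(* A later time, so that every t <= b is interior to [t / 2, b']. *)
have [b' bb' Tb'] := time_interval_between Tb.
have [m m1 Hm] := solution_uniform_lt1 Tb'.
have V0 : 0 <= V by apply: Rintegral_ge0.
have Gm0 : 0 <= G m by rewrite invr_ge0 ltW// g_gt0.
have ld0 : 0 <= lam * delta by rewrite mulr_ge0// ltW.
(* The first term pays for phi - h(phi) <= 2e with u < 1, the second for the same gap in the
   reaction term, where 1/g(u) <= [G m]. *)
exists (2 * V + 2 * (lam * delta) * G m * V).
  by rewrite addr_ge0// !mulr_ge0// ltW.
move=> e e0; have en0 := lt0r_neq0 e0.
have hphi x : B x -> 0 <= trunc0 e (phi x) /\ phi x - 2 * e <= trunc0 e (phi x) <= phi x.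
  move=> Bx; split; first exact: trunc0_ge0.
  by have := trunc0_bounds (phi x) e0; rewrite pospartE (ltW (phi_gt0 Bx)).
have [C2p _ eqp _ _] := eig.
have d0 s := is_derive_trunc0 s en0.
have d1 s := is_derive_trunc1 s en0.
have cd0 := continuous_trunc0 en0.
have out x : B x -> ~ superlevel B phi e x ->
    [/\ trunc0 e (phi x) = 0, trunc1 e (phi x) = 0 & trunc2 e (phi x) = 0].
  by move=> Bx nK; apply: trunc_small => //; exact: superlevel_out nK.
have cK := @superlevel_closed _ _ _ _ _ bB eig e.
have KB := superlevel_sub eig e0.
pose v x t := u x t * trunc0 e (phi x).
exists (fun t => \int[lebesgue_rV n]_(x in B) v x t) => t t0 tb.
have Tt : time_interval T t by exact: time_intervalW tb Tb.
have cu x s : B x -> time_interval T s ->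
    {for (x, s), continuous (fun p : 'rV[R]_n * R => u p.1 p.2)}.
  by move=> /BOm Omx Ts; have [] := sol_C21 sol Omx Ts.
have cv x s : B x -> time_interval T s -> {for x, continuous (v ^~ s)}.
  move=> Bx Ts; apply: for_continuousM; first exact: (slice_continuous (cu x s Bx Ts)).
  by apply: (for_continuous_comp (phi_continuous eig Bx)); exact: cd0.
have iv s : time_interval T s ->
    (lebesgue_rV n).-integrable B (EFin \o (v ^~ s)).
  move=> Ts; apply: (integrable_compact_support oB bB cK KB).
    by move=> x Bx; exact: cv.
  by move=> x Bx nK; rewrite /v; have [-> _ _] := out x Bx nK; rewrite mulr0.
have dv x s : B x -> time_interval T s ->
    is_derive s 1 (v x) (derive1 (u x) s * trunc0 e (phi x)).
  move=> /BOm Omx Ts; have [_ [du _] _ _] := sol_C21 sol Omx Ts.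
  have D : is_derive s 1 (u x) (derive1 (u x) s) by rewrite derive1E; exact: derivableP.
  have D2 : is_derive s 1 (v x) _ :=
    is_deriveM D (is_derive_cst (trunc0 e (phi x)) s 1).
  by apply: (is_derive_eq D2); rewrite /GRing.scale/= mulr0 add0r mulrC.
have dvE x s : B x -> time_interval T s ->
    derive1 (v x) s = derive1 (u x) s * trunc0 e (phi x).
  by move=> Bx Ts; rewrite derive1E; case: (dv _ _ Bx Ts).
have cdv x s : B x -> time_interval T s ->
    {for (x, s), continuous (fun p : 'rV[R]_n * R => derive1 (v p.1) p.2)}.
  move=> Bx Ts; have [_ [_ cdu] _ _] := sol_C21 sol (BOm Bx) Ts.
  apply: (@for_continuous_near _ _
    (fun p : 'rV[R]_n * R => derive1 (u p.1) p.2 * trunc0 e (phi p.1))).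
    by apply: filterS (nbhs_cylinder oB Bx Ts) => -[z r] [/= Bz Tr]; rewrite dvE.
  apply: for_continuousM => //.
  apply: (@for_continuous_comp _ _ _ (fun x => trunc0 e (phi x)) fst); first exact: cvg_fst.
  by apply: (for_continuous_comp (phi_continuous eig Bx)); exact: cd0.
split.
- apply: Rintegral_ge0 => x Bx.
  by rewrite mulr_ge0 ?u_ge0//; case: (hphi x Bx).
- apply: le_Rintegral => //; [exact: iv|exact: iuphi|].
  move=> x Bx; rewrite ler_wpM2l ?u_ge0//.
  by have [_ /andP[]] := hphi x Bx.
- apply: (@le_trans _ _ (\int[lebesgue_rV n]_(x in B) v x t + 2 * e * V)).
    rewrite /V -RintegralZl// -RintegralD//; [|exact: iv|exact: (integrableZl mB (2 * e) ione)].
    apply: le_Rintegral => //; first exact: iuphi.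
      exact: (integrableD mB (iv _ Tt) (integrableZl mB (2 * e) ione)).
    move=> x Bx; have [_ /andP[h1 _]] := hphi x Bx.
    have := u_ge0 Bx Tt; have := u_lt1 Bx Tt; rewrite /v; nra.
  rewrite lerD2l.
  have : 0 <= 2 * (lam * delta) * G m * V * e by rewrite !mulr_ge0// ltW.
  nra.
exists (\int[lebesgue_rV n]_(x in B) derive1 (v x) t).
  have Tab s : s \in `[t / 2, b'] -> time_interval T s.
    rewrite in_itv/= => /andP[at_ sb]; apply: (time_intervalW _ sb) => //.
    by apply: lt_le_trans at_; rewrite divr_gt0.
  apply: (is_derive_under_integral oB bB cK KB (a := t / 2) (b := b')).
  - by move=> x s Bx /Tab; exact: cv.
  - by move=> x s Bx /Tab Ts; case: (dv _ _ Bx Ts).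
  - by move=> x s Bx /Tab; exact: cdv.
  - by move=> x s Bx nK _; rewrite /v; have [-> _ _] := out x Bx nK; rewrite mulr0.
  - by rewrite in_itv/=; apply/andP; split; lra.
move=> s0 s01.
have C2u : C2_on B (u ^~ t).
  by move=> x /BOm Omx; exact: (C21_slice (sol_C21 sol) Tt).
have Gr := green_identity oB bB cK KB C2u C2p d0 d1 (@continuous_trunc2 _ e) out.
pose gi x := laplacian (u ^~ t) x * trunc0 e (phi x) -
    u x t * (trunc2 e (phi x) * (\sum_(i < n) partial i phi x ^+ 2)
           + trunc1 e (phi x) * laplacian phi x).
have igi : (lebesgue_rV n).-integrable B (EFin \o gi).
  apply: (integrable_compact_support oB bB cK KB).
    move=> x Bx; have [cux dux ddux] := C2u x Bx; have [cp dp ddp] := C2p x Bx.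
    apply: for_continuousB.
      apply: for_continuousM; first by apply: for_continuous_sum => i; exact: (ddux i i).2.
      by apply: (for_continuous_comp cp); exact: cd0.
    apply: for_continuousM => //; apply: for_continuousD; apply: for_continuousM.
    - by apply: (for_continuous_comp cp); exact: continuous_trunc2.
    - apply: for_continuous_sum => i.
      by apply: (@for_continuousM _ _ (partial i phi) (partial i phi)); exact: (dp i).2.
    - apply: (for_continuous_comp cp).
      exact: continuous_trunc1.
    - by apply: for_continuous_sum => i; exact: (ddp i i).2.
  move=> x Bx nK; rewrite /gi; have [-> -> ->] := out x Bx nK.
  by rewrite !mul0r addr0 !mulr0 subr0.
pose k := derive1 G s0.
have k0 : 0 <= k by exact: (derive1_G_ge0 C2g g_gt0 dg_le0 s01).
(* The lower bound regrouped as a combination of u phi, phi and 1. Adding [gi], whose integral is 0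
   by Green's identity, reduces the claim to a pointwise comparison of [P] with the time
   derivative. *)
pose c1 := - mu + lam * delta * k; pose c2 := lam * delta * (G s0 - k * s0).
pose c3 := - (2 * (lam * delta) * G m * e).
pose P x := gi x + (c1 * (u x t * phi x) + (c2 * phi x + c3 * 1)).
have i3 := integrableZl mB c3 ione.
have i2 := integrableZl mB c2 iphi.
have i1 := integrableZl mB c1 (iuphi Tt).
have i23 := integrableD mB i2 i3.
have i123 := integrableD mB i1 i23.
have iP := integrableD mB igi i123.
have PE : \int[lebesgue_rV n]_(x in B) P x = c1 * E t + (c2 + c3 * V).
  rewrite /P RintegralD// [X in X + _]Gr add0r RintegralD// RintegralZl//; last exact: iuphi.
  by rewrite RintegralD// RintegralZl// RintegralZl// phi_int1 mulr1.
apply: (@le_trans _ _ (\int[lebesgue_rV n]_(x in B) P x)).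
  rewrite PE /c1 /c2 /c3 -/k.
  have : 0 <= V * e by rewrite mulr_ge0// ltW.
  nra.
apply: le_Rintegral => //.
  apply: (integrable_compact_support oB bB cK KB).
    by move=> x Bx; have := slice_continuous (cdv x t Bx Tt).
  by move=> x Bx nK; rewrite dvE//; have [-> _ _] := out x Bx nK; rewrite mulr0.
move=> x Bx; rewrite dvE// (sol_equation sol (BOm Bx) Tt) /P /gi.
have lapE : laplacian phi x = - (mu * phi x) by rewrite -eqp// opprK.
have px := ltW (phi_gt0 Bx).
have ux0 := u_ge0 Bx Tt.
have [h_ge0 /andP[hl _]] := hphi x Bx.
have h2_ge0 := trunc2_ge0 (phi x) e0.
have /andP[_ h1_le1] := trunc1_bounds (phi x) e0.
have ineqA : 0 <= u x t * (trunc2 e (phi x) * (\sum_(i < n) partial i phi x ^+ 2)).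
  by rewrite mulr_ge0// mulr_ge0//; apply: sumr_ge0 => i _; exact: sqr_ge0.
(* Since mu, u and phi are nonnegative, h' <= 1 can only lessen the loss mu u phi. *)
have ineqB : u x t * (trunc1 e (phi x) * (mu * phi x)) <= mu * (u x t * phi x).
  have up : 0 <= mu * (u x t * phi x) by rewrite !mulr_ge0.
  have := ler_wpM2r up h1_le1; lra.
have Gu_ge0 : 0 <= G (u x t) by rewrite invr_ge0 ltW// g_gt0// u_lt1.
have GuGm : G (u x t) <= G m.
  by apply: (G_nondecreasing C2g g_gt0 dg_le0) => //; apply: Hm => //; lra.
have tang : G s0 + k * (u x t - s0) <= G (u x t).
  by apply: (G_tangent C2g g_gt0 ddG_ge0) => //; exact: u_lt1.
(* Replacing h(phi) by phi - 2e costs at most 2e [G m]; the tangent then bounds phi / g(u) from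
   below because phi >= 0. *)
have ineqC : lam * delta * ((G s0 + k * (u x t - s0)) * phi x - 2 * e * G m) <=
    lam * (f x / g (u x t)) * trunc0 e (phi x).
  apply: (@le_trans _ _ (lam * delta * (G (u x t) * trunc0 e (phi x)))).
    rewrite ler_wpM2l//.
    have H1 := ler_wpM2r px tang.
    have H2 := ler_wpM2l Gu_ge0 hl.
    have H3 : e * G (u x t) <= e * G m by rewrite ler_wpM2l// ltW.
    lra.
  have H4 : delta * (G (u x t) * trunc0 e (phi x)) <= f x * (G (u x t) * trunc0 e (phi x)).
    by rewrite ler_wpM2r ?f_delta// mulr_ge0.
  by have := ler_wpM2l lam_ge0 H4; rewrite /G; lra.
rewrite lapE /c1 /c2 /c3; exact: density_bound.
Qed.

Let E0 := \int[lebesgue_rV n]_(x in B) (u0 x * phi x).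

Let iu0 : (lebesgue_rV n).-integrable B (EFin \o u0).
Proof. by case: u0_init => iu _; exact: (integrableS (open_measurable_rV oOm) mB BOm iu). Qed.

Let mu0 : measurable_fun B u0.
Proof. by apply/measurable_EFinP; move/integrableP : iu0 => []. Qed.

Let iu0phi : (lebesgue_rV n).-integrable B (EFin \o (fun x => u0 x * phi x)).
Proof.
have [M M0 HM] := phi_bounded bB eig.
apply: (le_integrable mB _ _ (integrableZl mB M iu0)).
  by apply/measurable_EFinP; exact: measurable_funM.
move=> x Bx /=; rewrite lee_fin !normrM mulrC ler_wpM2r//.
by rewrite (ger0_norm M0) (ger0_norm (ltW (phi_gt0 Bx))) HM.
Qed.

Lemma initial_energy_lt1 : E0 < 1.
Proof.
have [_ [a [a0 a1 ua]]] := u0_init.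
(* The bound by a holds only almost everywhere; capping u0 at a leaves the integral unchanged and
   makes the bound hold everywhere. *)
have E0E : E0 = \int[lebesgue_rV n]_(x in B) (Num.min (u0 x) a * phi x).
  rewrite /E0 /Rintegral; congr fine; apply: ae_eq_integral => //.
  - by apply/measurable_EFinP; exact: measurable_funM.
  - apply/measurable_EFinP; apply: measurable_funM => //.
    by apply: measurable_minr => //; exact: measurable_cst.
  - apply: filterS ua => x Hx Bx; congr (_ * _)%:E.
    by rewrite (min_idPl _)// Hx//; exact: BOm.
apply: le_lt_trans a1; rewrite E0E.
apply: (@le_trans _ _ (\int[lebesgue_rV n]_(x in B) (a * phi x))); last first.
  by rewrite RintegralZl// phi_int1 mulr1.
apply: le_Rintegral => //.
- apply: (le_integrable mB _ _
    (integrableD mB (integrable_norm iu0phi) (integrableZl mB a iphi))).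
    apply/measurable_EFinP; apply: measurable_funM => //.
    by apply: measurable_minr => //; exact: measurable_cst.
  move=> x Bx; have px := phi_gt0 Bx.
  rewrite -[X in (_ <= `| X |)%E]/((`|u0 x * phi x| + a * phi x)%:E).
  rewrite /= lee_fin normrM (ger0_norm (ltW px)).
  have -> : `| `|u0 x * phi x| + a * phi x | = (`|u0 x| + a) * phi x.
    by rewrite normrM (ger0_norm (ltW px)) -mulrDl [LHS]ger0_norm// mulr_ge0 ?addr_ge0// ltW.
  rewrite ler_wpM2r ?(ltW px)//.
  by rewrite minEle; case: ifPn => _; [rewrite lerDl ltW|rewrite (gtr0_norm a0) lerDr].
- by have := integrableZl mB a iphi.
- by move=> x Bx; rewrite ler_wpM2r ?ge_min ?lexx ?orbT// ltW// phi_gt0.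
Qed.

(** As phi is bounded, L^1 convergence of u passes to E. Arbitrarily small times s are all that the
    integration in time needs. *)
Lemma energy_initial (eta t : R) : 0 < eta -> time_interval T t ->
  exists s, [/\ 0 < s, s <= t & `|E s - E0| <= eta].
Proof.
move=> eta0 Tt; have [M M0 HM] := phi_bounded bB eig.
have M1 : 0 < M + 1 by rewrite ltr_wpDl.
have eM0 : 0 < eta / (M + 1) by rewrite divr_gt0.
have ev : \forall s \near 0^'+,
    (\int[lebesgue_rV n]_(x in Om) `|u x s - u0 x|%:E < (eta / (M + 1))%:E)%E.
  have : \forall y \near (0%E : \bar R), (y < (eta / (M + 1))%:E)%E.
    exact: lt_nbhsl.
  exact: (sol_initial sol).
have t0 : 0 < t by case: Tt.
have [s [s0 st Hs]] : exists s, [/\ 0 < s, s <= t &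
    (\int[lebesgue_rV n]_(x in Om) `|u x s - u0 x|%:E < (eta / (M + 1))%:E)%E].
  near (0 : R)^'+ => s; exists s; split.
  - by near: s; exact: nbhs_right_gt.
  - by near: s; exact: nbhs_right_le.
  - by near: s; exact: ev.
exists s; split => //.
have Ts := time_intervalW s0 st Tt.
have mOm := open_measurable_rV oOm.
have mus := solution_measurable oOm sol Ts.
have mu0Om : measurable_fun Om u0.
  by case: u0_init => /integrableP[/measurable_EFinP].
rewrite /E /E0 -RintegralB//; last exact: iuphi.
have iD := integrableB mB (iuphi Ts) iu0phi.
apply: (le_trans (le_normr_Rintegral mB iD)).
rewrite -lee_fin /Rintegral fineK; last first.
  by apply: integrable_fin_num => //; have := integrable_norm iD.
apply: (@le_trans _ _ (\int[lebesgue_rV n]_(x in B) ((M + 1)%:E * `|u x s - u0 x|%:E))%E).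
  apply: ge0_le_integral => //.
  - by have /integrableP[/measurable_EFinP mD _] := iD;
      apply/measurable_EFinP; exact: measurableT_comp.
  - apply/measurable_EFinP; apply: measurable_funM => //.
    apply: measurableT_comp => //; apply: measurable_funB => //.
    exact: measurable_funS mus.
  - move=> x Bx; rewrite -EFinM lee_fin -mulrBl normrM mulrC ler_wpM2r//.
    by rewrite ger0_norm ?(ltW (phi_gt0 Bx))// (le_trans (HM _ Bx))// lerDl.
have mabs : measurable_fun Om (fun x => `|u x s - u0 x|%:E).
  by apply/measurable_EFinP; apply: measurableT_comp => //; exact: measurable_funB.
rewrite ge0_integralZl//; [|exact: measurable_funS mabs|by rewrite lee_fin ltW].
rewrite -[eta](@divfK _ (M + 1)) ?gt_eqF// mulrC EFinM.
rewrite lee_pmul2l ?lte_fin//; apply: le_trans (ltW Hs).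
by apply: ge0_subset_integral => //.
Unshelve. all: end_near. Qed.

Lemma initial_energy_ge0 : 0 <= E0.
Proof.
apply/ler_addgt0Pl => eta eta0; rewrite addrC.
have [b Tb] : exists b, time_interval T b.
  have := sol_T_gt0 sol; case: T => [r| |] // r0.
    by exists (r / 2); rewrite lte_fin in r0; split; [|rewrite lte_fin]; lra.
  by exists 1; split => //; exact: ltry.
have [s [s0 sb]] := energy_initial eta0 Tb.
have /andP[Es0 _] := energy_bounds (time_intervalW s0 sb Tb).
by rewrite ler_norml => /andP[]; lra.
Qed.

End energy.

(** * Integrating the energy inequality *)

Section differential_inequality.
Context {R : realType}.
Variables (g : R -> R) (lam mu delta E0 : R) (T : \bar R) (E : R -> R).
Hypotheses (C2g : C2_lt1 g) (g_gt0 : forall s, s < 1 -> 0 < g s).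
Hypothesis dg_le0 : forall s, s < 1 -> derive1 g s <= 0.
Let G s := (g s)^-1.
Hypotheses (lam_ge0 : 0 <= lam) (delta_gt0 : 0 < delta) (mu_ge0 : 0 <= mu).
Hypothesis E_bounds : forall t, time_interval T t -> 0 <= E t < 1.
Hypotheses (E0_ge0 : 0 <= E0) (E0_lt1 : E0 < 1).
Hypothesis E_initial : forall eta t : R, 0 < eta -> time_interval T t ->
  exists s, [/\ 0 < s, s <= t & `|E s - E0| <= eta].
Hypothesis E_ineq : forall b, time_interval T b ->
  exists2 C, 0 <= C & forall e, 0 < e -> exists y : R -> R,
  forall t, 0 < t -> t <= b ->
  [/\ 0 <= y t, y t <= E t, E t <= y t + C * e &
    exists2 dy : R, is_derive t 1 y dy & forall s0, s0 < 1 ->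
      - mu * E t + lam * delta * (G s0 + derive1 G s0 * (E t - s0)) - C * e <= dy].

Lemma is_derive_ge0_le (z dz : R -> R) (s t : R) : s <= t ->
  (forall r : R, s <= r -> r <= t -> is_derive r 1 z (dz r) /\ 0 <= dz r) -> z s <= z t.
Proof.
move=> st H; apply: (@ger0_derive1_ndecr _ z s t) => //.
- move=> r; rewrite in_itv/= => /andP[/ltW sr /ltW rt].
  by have [[]] := H r sr rt.
- move=> r; rewrite in_itv/= => /andP[/ltW sr /ltW rt].
  by have [[_ D] ?] := H r sr rt; rewrite derive1E D.
- apply: derivable_within_continuous => r; rewrite in_itv/= => /andP[sr rt].
  by have [[]] := H r sr rt.
Qed.

(** The choice e = d / (C + 1) makes the error C e at most d, also when C = 0. *)
Lemma E_ineq_small b d : time_interval T b -> 0 < d -> exists2 c, 0 <= c <= d &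
  exists y : R -> R, forall t, 0 < t -> t <= b ->
  [/\ 0 <= y t, y t <= E t, E t <= y t + c &
    exists2 dy : R, is_derive t 1 y dy & forall s0, s0 < 1 ->
      - mu * E t + lam * delta * (G s0 + derive1 G s0 * (E t - s0)) - c <= dy].
Proof.
move=> Tb d0; have [C C0 HC] := E_ineq Tb.
have C1 : 0 < C + 1 by rewrite ltr_wpDl.
have e0 : 0 < d / (C + 1) by rewrite divr_gt0.
exists (C * (d / (C + 1))); last exact: HC.
rewrite mulr_ge0 ?(ltW e0)//= mulrA ler_pdivrMr// mulrC ler_wpM2l ?(ltW d0)//.
by rewrite lerDl.
Qed.

(** * Initial energy above the threshold *)

Section large_initial_energy.
Variable a : R.
Hypotheses (a_lt1 : a < 1) (aE0 : a <= E0).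
Hypothesis Ga : 10 <= lam * delta * G a - mu.

Let k := lam * delta * derive1 G a.

Let k_ge0 : 0 <= k.
Proof.
by rewrite mulr_ge0 ?mulr_ge0 ?(ltW delta_gt0)// (derive1_G_ge0 C2g g_gt0 dg_le0).
Qed.

(** As E < 1 and mu >= 0, the loss mu E is at most mu, and [Ga] leaves 10 of the reaction term. *)
Let rhs_ge t c : time_interval T t ->
  10 + k * (E t - a) - c <=
  - mu * E t + lam * delta * (G a + derive1 G a * (E t - a)) - c.
Proof.
move=> Tt; have /andP[E1 E2] := E_bounds Tt.
have : mu * E t <= mu by rewrite ler_piMr// ltW.
move: Ga; rewrite /k; move: (G a) (derive1 G a) (E t) => x y z; lra.
Qed.

(* Gronwall with the weight [expR (- k t)]. *)
Lemma energy_stays_above t : time_interval T t -> a <= E t.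
Proof.
move=> Tt; have t0 : 0 < t by case: Tt.
have kt_gt0 := expR_gt0 (k * t).
apply/ler_addgt0Pl => d d0.
(* At time s, y - a is at least -2 eta: one eta for E s against E0, one for y against E. Undoing the
   weight multiplies this by at most expR (k t), which d absorbs; eta <= 1 keeps 10 - c
   nonnegative. *)
pose eta := Num.min 1 (d / expR (k * t) / 2).
have eta0 : 0 < eta by rewrite lt_min ltr01 !divr_gt0.
have etad : 2 * (eta * expR (k * t)) <= d.
  have : eta <= d / expR (k * t) / 2 by rewrite ge_min lexx orbT.
  by rewrite ler_pdivlMr// ler_pdivlMr// mulrA (mulrC 2).
have eta1 : eta <= 1 by rewrite ge_min lexx.
clearbody eta.
have [s [s0 st Es]] := E_initial eta0 Tt.
have [c /andP[c0 ceta] [y Hy]] := E_ineq_small Tt eta0.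
pose z r := expR (- k * r) * (y r - a).
have zst : z s <= z t.
  apply: (is_derive_ge0_le (z := z)
    (dz := fun r => expR (- k * r) * (derive1 y r - k * (y r - a))) st) => r sr rt.
  have r0 := lt_le_trans s0 sr.
  have [_ yE _ [dy Dy /(_ a a_lt1) Hdy]] := Hy r r0 rt.
  have dyE : derive1 y r = dy by rewrite derive1E; case: Dy.
  have D1 : is_derive r 1 (fun r : R => - k * r) (- k).
    have := @is_deriveZ _ _ _ id (- k) r 1 1 (is_derive_id _ _).
    by rewrite /GRing.scale/= mulr1.
  have D2 := @is_derive1_comp _ expR (fun r : R => - k * r) r _ _ (is_derive_expR _) D1.
  have D3 : is_derive r 1 (fun r => y r - a) dy.
    have := is_deriveB Dy (is_derive_cst a r 1); rewrite subr0; exact.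
  have D4 : is_derive r 1 z _ := is_deriveM D2 D3.
  split; first by apply: (is_derive_eq D4); rewrite dyE /GRing.scale/=; ring.
  rewrite mulr_ge0 ?expR_ge0// dyE subr_ge0.
  apply: le_trans Hdy; apply: le_trans (rhs_ge _ (time_intervalW r0 rt Tt)).
  have : k * (y r - a) <= k * (E r - a) by rewrite ler_wpM2l// lerD2r.
  lra.
have [_ _ Esy _] := Hy s s0 st.
have [_ yEt _ _] := Hy t t0 (lexx t).
have ks1 : expR (- k * s) <= 1.
  by rewrite -expR0 ler_expR mulNr oppr_le0 mulr_ge0// ltW.
have ks0 := expR_ge0 (- k * s).
have zs : - (2 * eta) <= z s.
  have ys : - (2 * eta) <= y s - a by move: Es aE0; rewrite ler_norml => /andP[]; lra.
  rewrite /z; nra.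
have zt : - (2 * eta) * expR (k * t) <= y t - a.
  have : - (2 * eta) <= z t by exact: le_trans zst.
  by rewrite /z mulNr expRN ler_pdivlMl// mulrC.
lra.
Qed.

Lemma time_bound_large t : time_interval T t -> 10 * t <= 1 - a.
Proof.
move=> Tt; have t0 : 0 < t by case: Tt.
apply/ler_addgt0Pl => d d0.
(* Errors in units of eta: 1 for E s against E0, 1 for y against E, 10 for the time before s, t for
   the loss c in the growth rate; 13 leaves a margin. *)
have K0 : 0 < 13 + t by lra.
pose eta := d / (13 + t).
have eta0 : 0 < eta by rewrite divr_gt0.
have etad : eta * (13 + t) = d by rewrite /eta divfK// gt_eqF.
clearbody eta.
pose b := Num.min t eta.
have b0 : 0 < b by rewrite lt_min t0.
have bt : b <= t by rewrite ge_min lexx.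
have [s [s0 sb Es]] := E_initial eta0 (time_intervalW b0 bt Tt).
have st := le_trans sb bt.
have seta : s <= eta by apply: (le_trans sb); rewrite ge_min lexx orbT.
have [c /andP[c0 ceta] [y Hy]] := E_ineq_small Tt eta0.
have Y : y s - (10 - c) * s <= y t - (10 - c) * t.
  apply: (is_derive_ge0_le (z := fun r => y r - (10 - c) * r)
    (dz := fun r => derive1 y r - (10 - c)) st) => r sr rt.
  have r0 := lt_le_trans s0 sr.
  have [_ yE _ [dy Dy /(_ a a_lt1) Hdy]] := Hy r r0 rt.
  have dyE : derive1 y r = dy by rewrite derive1E; case: Dy.
  split.
    have D1 := @is_deriveZ _ _ _ id (10 - c) r 1 1 (is_derive_id _ _).
    have D2 : is_derive r 1 (fun r => y r - (10 - c) * r) _ := is_deriveB Dy D1.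
    by apply: (is_derive_eq D2); rewrite dyE /GRing.scale/= mulr1.
  rewrite dyE subr_ge0; apply: le_trans Hdy.
  have Tr := time_intervalW r0 rt Tt.
  apply: le_trans (rhs_ge _ Tr).
  have : 0 <= k * (E r - a) by rewrite mulr_ge0// subr_ge0 energy_stays_above.
  lra.
have [_ _ Esy _] := Hy s s0 st.
have [_ yEt _ _] := Hy t t0 (lexx t).
have /andP[_ Et1] := E_bounds Tt.
have h1 : c * (t - s) <= eta * t by nra.
move: Es aE0; rewrite ler_norml => /andP[Es _].
lra.
Qed.

End large_initial_energy.

(** The base point -1 lies strictly below the range of y, so that the derivative is two-sided even
    where y = 0. *)
Lemma g_primitive : exists Gam : R -> R,
  forall s : R, -1 < s -> s < 1 -> is_derive s 1 Gam (g s).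
Proof.
exists (fun s => \int[lebesgue_measure]_(r in `[(-1)%R, s]) g r) => s s1 s2.
pose v := (s + 1) / 2.
have sv : s < v by rewrite /v; lra.
have v1 : v < 1 by rewrite /v; lra.
have ig : (@lebesgue_measure R).-integrable `[-1, v] (EFin \o g).
  apply: continuous_compact_integrable; first exact: segment_compact.
  apply: derivable_within_continuous => r; rewrite in_itv/= => /andP[_ rv].
  exact: (derivable_g C2g (le_lt_trans rv v1)).
have [D1 D2] := continuous_FTC1_closed sv ig s1 (continuous_g C2g s2).
by split; [exact: D1|rewrite -derive1E].
Qed.

(** * Time bound by the integral of [g] *)

Section small_initial_energy.
Variable kap : R.
Hypothesis kap_gt0 : 0 < kap.
Hypothesis kap_le : forall s, 0 <= s -> s < 1 ->
  kap * G s <= lam * delta * G s - mu * s.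

(** At the tangent point E t the linear term drops out, leaving y' >= kap G(E) - c. Since y <= E and
    g is nonincreasing, g(y) G(E) >= 1, so the derivative of Gam(y) is at least kap - g(0) c. *)
Lemma time_bound_integral t : time_interval T t ->
  ((kap * t)%:E <= \int[lebesgue_measure]_(s in `[E0, 1%R[) (g s)%:E)%E.
Proof.
move=> Tt; have t0 : 0 < t by case: Tt.
have [Gam dGam] := g_primitive.
have g00 : 0 < g 0 by exact: g_gt0.
have gle0 s : 0 <= s -> s < 1 -> g s <= g 0.
  by move=> s0 s1; exact: (g_nonincreasing C2g dg_le0).
have Gam_mono x y : 0 <= x -> x <= y -> y < 1 -> Gam x <= Gam y.
  move=> x0 xy y1; apply: (is_derive_ge0_le (dz := g) xy) => r xr ry.
  have r0 := le_trans x0 xr; have r1 := le_lt_trans ry y1.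
  by split; [apply: dGam => //; lra|exact/ltW/g_gt0].
have Gam_lip x y : 0 <= x -> x <= y -> y < 1 -> Gam y <= Gam x + g 0 * (y - x).
  move=> x0 xy y1.
  have : g 0 * x - Gam x <= g 0 * y - Gam y.
    apply: (is_derive_ge0_le (z := fun r => g 0 * r - Gam r)
      (dz := fun r => g 0 - g r) xy) => r xr ry.
    have r0 := le_trans x0 xr; have r1 := le_lt_trans ry y1.
    split; last by rewrite subr_ge0 gle0.
    have D1 := @is_deriveZ _ _ _ id (g 0) r 1 1 (is_derive_id _ _).
    have r1' : -1 < r by lra.
    have D2 : is_derive r 1 (fun r => g 0 * r - Gam r) _ :=
      is_deriveB D1 (dGam r r1' r1).
    by apply: (is_derive_eq D2); rewrite /GRing.scale/= mulr1.
  lra.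
have /andP[Et0 Et1] := E_bounds Tt.
have main : kap * t <= Gam (E t) - Gam E0.
  apply/ler_addgt0Pl => d d0.
  have g0t : 0 <= g 0 * t by rewrite mulr_ge0// ltW.
  (* The errors are kap s, g(0) c (t - s) and, at time s, g(0) eta twice: for y against E and for E
     against E0. Here g(0) is a Lipschitz constant of [Gam] on [0, 1[. *)
  have K0 : 0 < kap + g 0 * t + 2 * g 0 by have := kap_gt0; lra.
  pose eta := d / (kap + g 0 * t + 2 * g 0).
  have eta0 : 0 < eta by rewrite divr_gt0.
  have etad : eta * (kap + g 0 * t + 2 * g 0) = d by rewrite /eta divfK// gt_eqF.
  clearbody eta.
  have b0 : 0 < Num.min t eta by rewrite lt_min t0.
  have bt : Num.min t eta <= t by rewrite ge_min lexx.
  have [s [s0 sb Es]] := E_initial eta0 (time_intervalW b0 bt Tt).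
  have st := le_trans sb bt.
  have seta : s <= eta by apply: (le_trans sb); rewrite ge_min lexx orbT.
  have [c /andP[c0 ceta] [y Hy]] := E_ineq_small Tt eta0.
  have W : Gam (y s) - (kap - g 0 * c) * s <= Gam (y t) - (kap - g 0 * c) * t.
    apply: (is_derive_ge0_le (z := fun r => Gam (y r) - (kap - g 0 * c) * r)
      (dz := fun r => g (y r) * derive1 y r - (kap - g 0 * c)) st) => r sr rt.
    have r0 := lt_le_trans s0 sr.
    have /andP[Er0 Er1] := E_bounds (time_intervalW r0 rt Tt).
    have [y0 yE _ [dy Dy /(_ _ Er1) Hdy]] := Hy r r0 rt.
    have y1 := le_lt_trans yE Er1.
    have yN1 : -1 < y r by lra.
    have dyE : derive1 y r = dy by rewrite derive1E; case: Dy.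
    split.
      have D1 := @is_deriveZ _ _ _ id (kap - g 0 * c) r 1 1 (is_derive_id _ _).
      have D3 := is_derive1_comp (dGam _ yN1 y1) Dy.
      have D2 : is_derive r 1 (fun r => Gam (y r) - (kap - g 0 * c) * r) _ :=
        is_deriveB D3 D1.
      by apply: (is_derive_eq D2); rewrite dyE /GRing.scale/= mulr1.
    rewrite dyE subr_ge0.
    have gy0 := g_gt0 y1; have gE0 := g_gt0 Er1.
    have gyE := g_nonincreasing C2g dg_le0 yE Er1.
    have H1 : kap * G (E r) - c <= dy.
      apply: le_trans Hdy; rewrite subrr mulr0 addr0.
      by have := kap_le Er0 Er1; lra.
    have H2 : 1 <= g (y r) * G (E r) by rewrite /G ler_pdivlMr// mul1r.
    have H3 := ler_wpM2l (ltW gy0) H1.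
    have H4 := ler_wpM2l (ltW kap_gt0) H2.
    have H5 := ler_wpM2r c0 (gle0 _ y0 y1).
    apply: le_trans H3; lra.
  have [ys0 ysE Esy _] := Hy s s0 st.
  have [yt0 yEt _ _] := Hy t t0 (lexx t).
  have /andP[Es0 Es1] := E_bounds (time_intervalW s0 st Tt).
  have A1 := Gam_mono _ _ yt0 yEt Et1.
  have A2 := Gam_lip _ _ ys0 ysE Es1.
  have A3 : Gam E0 <= Gam (E s) + g 0 * eta.
    have ge : 0 <= g 0 * eta by rewrite mulr_ge0// ltW.
    have [EE|EE] := leP E0 (E s).
      by have := Gam_mono _ _ E0_ge0 EE Es1; lra.
    have := Gam_lip _ _ Es0 (ltW EE) E0_lt1.
    have : g 0 * (E0 - E s) <= g 0 * eta.
      by rewrite ler_wpM2l ?(ltW g00)//; move: Es; rewrite ler_norml => /andP[]; lra.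
    lra.
  have A4 : g 0 * (E s - y s) <= g 0 * eta by rewrite ler_wpM2l ?(ltW g00)//; lra.
  have A5 : g 0 * c * (t - s) <= g 0 * eta * t.
    apply: ler_pM; [by rewrite mulr_ge0// ltW|lra| |lra].
    by rewrite ler_wpM2l// ltW.
  have A6 : kap * s <= kap * eta by rewrite ler_wpM2l// ltW.
  lra.
(* Strict growth orients the interval from E0 to E t, as the fundamental theorem of calculus
   requires. *)
have EE : E0 < E t.
  rewrite ltNge; apply/negP => EE.
  have := Gam_mono _ _ Et0 EE E0_lt1.
  have : 0 < kap * t by rewrite mulr_gt0.
  lra.
have cg : {within `[E0, E t], continuous g}.
  apply: derivable_within_continuous => r; rewrite in_itv/= => /andP[_ rv].
  exact: (derivable_g C2g (le_lt_trans rv Et1)).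
have dE0 : derivable_oo_LRcontinuous Gam E0 (E t).
  have D r : E0 <= r -> r <= E t -> derivable Gam r 1.
    move=> r1 r2; have r0 := le_trans E0_ge0 r1.
    by have [] : is_derive r 1 Gam (g r) by apply: dGam; lra.
  split.
  - by move=> r; rewrite in_itv/= => /andP[/ltW r1 /ltW r2]; exact: D.
  - by apply: cvg_at_right_filter; apply: differentiable_continuous;
      apply/derivable1_diffP/D => //; exact: ltW.
  - by apply: cvg_at_left_filter; apply: differentiable_continuous;
      apply/derivable1_diffP/D => //; exact: ltW.
have GE : {in `]E0, E t[, derive1 Gam =1 g}.
  move=> r; rewrite in_itv/= => /andP[r1 r2]; have r0 := le_lt_trans E0_ge0 r1.
  by rewrite derive1E; have [] : is_derive r 1 Gam (g r) by apply: dGam; lra.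
apply: (@le_trans _ _ (\int[lebesgue_measure]_(s in `[E0, E t]) (g s)%:E)%E).
  by rewrite (continuous_FTC2 EE cg dE0 GE) -EFinB lee_fin.
apply: ge0_subset_integral => //.
- apply/measurable_EFinP; apply: subspace_continuous_measurable_fun => //.
  apply: derivable_within_continuous => r; rewrite in_itv/= => /andP[_ rv].
  exact: (derivable_g C2g rv).
- by move=> r; rewrite /= in_itv/= => /andP[_ r1]; rewrite lee_fin ltW// g_gt0.
- by move=> r; rewrite /= !in_itv/= => /andP[-> r1] /=; exact: le_lt_trans Et1.
Qed.

End small_initial_energy.
End differential_inequality.

(** * From the energy to the touchdown time *)

Lemma open_euclid_ball (R : realType) n (x0 : 'rV[R]_n) rho :
  open (euclid_ball x0 rho).
Proof.
have cn : continuous (fun x : 'rV[R]_n => euclid_norm (x - x0)).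
  move=> x; apply: (@for_continuous_comp _ _ _ (@Num.sqrt R)
    (fun x : 'rV[R]_n => \sum_(i < n) (x - x0) ord0 i ^+ 2)).
    apply: for_continuous_sum => i.
    have cxi : {for x, continuous (fun y : 'rV[R]_n => (y - x0) ord0 i)}.
      rewrite (_ : (fun y => _) = (fun y : 'rV[R]_n => y ord0 i - x0 ord0 i)).
        apply: for_continuousB; last exact: for_continuous_cst.
        exact: (@coord_continuous R 1 n ord0 i x).
      by apply/funext => y; rewrite !mxE.
    exact: (for_continuousM cxi cxi).
  exact: sqrt_continuous.
rewrite (_ : euclid_ball x0 rho =
  (fun x : 'rV[R]_n => euclid_norm (x - x0)) @^-1` [set r | r < rho]) //.
by apply: open_comp; [move=> x _; exact: cn|exact: open_lt].
Qed.

(** The estimates bound each time before [T], and [T] may be infinite; [0 <= X] covers an empty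
    interval. *)
Lemma time_interval_le (R : realType) (T X : \bar R) : (0 <= X)%E ->
  (forall t, time_interval T t -> (t%:E <= X)%E) -> (T <= X)%E.
Proof.
move=> X0 H; rewrite leNgt; apply/negP; case: X X0 H => [r| |] //; last by case: T.
rewrite lee_fin => r0 H rT.
have [t rt Tt] : exists2 t, r < t & time_interval T t.
  case: T rT {H} => [q| |] // rq.
    rewrite lte_fin in rq; exists ((r + q) / 2); first lra.
    by split; [|rewrite lte_fin]; lra.
  by exists (r + 1); [lra|split; [lra|exact: ltry]].
by have := H t Tt; rewrite lee_fin leNgt rt.
Qed.

Theorem corollary3p4 (R : realType) (n : nat) (Om : set 'rV[R]_n)
    (f : 'rV[R]_n -> R) (alpha : R) (g : R -> R)
    (x0 : 'rV[R]_n) (rho mu : R) (phi : 'rV[R]_n -> R) :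
  (0 < n)%N ->
  bounded_C2_domain Om ->
  0 < alpha < 1 ->
  holder_on (closure Om) alpha f ->
  (forall x, closure Om x -> 0 <= f x) ->
  (exists2 x, closure Om x & f x != 0) ->
  let B := euclid_ball x0 rho in
  let delta := inf (f @` B) in
  0 < rho ->
  B `<=` Om ->
  0 < delta ->
  C2_lt1 g ->
  (forall s, s < 1 -> 0 < g s) ->
  (forall s, s < 1 -> derive1 g s <= 0) ->
  (forall s, s < 1 -> 0 <= derive1n 2 (fun y => (g y)^-1) s) ->
  first_dirichlet_eigenvalue B mu ->
  dirichlet_eigenfunction B mu phi ->
  (forall x, B x -> 0 < phi x) ->
  \int[lebesgue_rV n]_(x in B) phi x = 1 ->
  let lamR := mu / delta * sup [set s * g s | s in `[0, 1[] in
  let E1 := fun u0 : 'rV[R]_n -> R =>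
    \int[lebesgue_rV n]_(x in B) (u0 x * phi x) in
  (forall (lam : R) (u0 : 'rV[R]_n -> R) (T : \bar R) (u : 'rV[R]_n -> R -> R),
    lamR < lam ->
    initial_datum Om u0 ->
    {ae lebesgue_rV n, forall x, Om x -> 0 <= u0 x} ->
    solution Om f g lam u0 T u ->
    touchdown_time Om u T ->
    (T <= (((lam - lamR) * delta)^-1)%:E *
          \int[lebesgue_measure]_(s in `[E1 u0, 1%R[) (g s)%:E)%E) /\
  (g s @[s --> 1^'-] --> 0 ->
   forall lam : R, 0 < lam ->
   exists a1 : R, a1 < 1 /\
   forall (u0 : 'rV[R]_n -> R) (T : \bar R) (u : 'rV[R]_n -> R -> R),
     initial_datum Om u0 ->
     {ae lebesgue_rV n, forall x, Om x -> 0 <= u0 x} ->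
     a1 <= E1 u0 ->
     solution Om f g lam u0 T u ->
     touchdown_time Om u T ->
     (T <= ((1 - a1) / 10)%:E)%E).
Proof.
move=> n0 [oOm _ bOm _] _ _ f_ge0 _ B delta rho0 BOm delta0 C2g g_gt0 dg_le0 ddG_ge0.
move=> _ eig phi_gt0 phi_int1 lamR E1.
have oB : open B by exact: open_euclid_ball.
have bB : bounded_set B.
  by move: bOm => [M [Mr HM]]; exists M; split=> // y My x Bx; apply: HM => //; exact: BOm.
have mu_ge0 := dirichlet_eigenvalue_ge0 oB bB eig phi_gt0.
have f_delta x : B x -> delta <= f x.
  move=> Bx; apply: ge_inf; last by exists x.
  by exists 0 => _ [y By <-]; apply: f_ge0; exact/subset_closure/BOm.
(* The real [sup] is 0 by default on a set without upper bound; by monotonicity of g, [g 0] is a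
   bound here. *)
have ub : has_ubound [set s * g s | s in `[0, 1[].
  exists (g 0) => y [r]; rewrite /= in_itv/= => /andP[r0 r1] <-.
  have gr := g_nonincreasing C2g dg_le0 r0 r1; have gr0 := g_gt0 _ r1.
  by apply: le_trans gr; rewrite ler_piMl// ltW.
pose S := sup [set s * g s | s in `[0, 1[].
have supP s : 0 <= s -> s < 1 -> s * g s <= S.
  move=> s_ge0 s1; apply: (ub_le_sup ub); exists s => //.
  by rewrite /= in_itv/= s_ge0.
have S_ge0 : 0 <= S by have := supP 0 (lexx 0) ltr01; rewrite mul0r.
have lamR_ge0 : 0 <= lamR by rewrite mulr_ge0// divr_ge0// ltW.
split=> [lam u0 T u lamR_lt u0i u0_ge0 sol _|g1 lam lam0].
  have lam_ge0 : 0 <= lam by lra.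
  have kap0 : 0 < (lam - lamR) * delta by rewrite mulr_gt0// subr_gt0.
  (* With S the supremum of s g(s), mu s <= mu S / g(s), and mu S = lamR delta: this is where lamR
     comes from. *)
  have kap_le s : 0 <= s -> s < 1 ->
      (lam - lamR) * delta * (g s)^-1 <= lam * delta * (g s)^-1 - mu * s.
    move=> s_ge0 s1; have gs := g_gt0 _ s1.
    have -> : (lam - lamR) * delta = lam * delta - mu * S.
      by rewrite /lamR -/S; field; rewrite gt_eqF.
    rewrite mulrBl lerD2l lerN2 -mulrA ler_wpM2l// ler_pdivlMr//.
    exact: supP.
  apply: time_interval_le.
    rewrite mule_ge0// ?lee_fin ?invr_ge0 ?(ltW kap0)//.
    apply: integral_ge0 => s; rewrite /= in_itv/= => /andP[_ s1].
    by rewrite lee_fin ltW// g_gt0.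
  move=> t Tt; rewrite lee_pdivlMl//.
  apply: (time_bound_integral C2g g_gt0 dg_le0 _ _ _ _ _ kap0 kap_le Tt).
  - exact: (energy_bounds oOm bOm oB BOm f_ge0 g_gt0 eig phi_gt0 phi_int1 lam_ge0 u0i u0_ge0 sol).
  - exact: (initial_energy_ge0 oOm bOm oB BOm f_ge0 g_gt0 eig phi_gt0 phi_int1 lam_ge0 u0i u0_ge0 sol).
  - exact: (initial_energy_lt1 oOm bOm oB BOm eig phi_gt0 phi_int1 u0i).
  - exact: (energy_initial oOm bOm oB BOm f_ge0 g_gt0 eig phi_gt0 lam_ge0 u0i u0_ge0 sol).
  - exact: (energy_inequality oOm bOm oB BOm f_ge0 delta0 f_delta C2g g_gt0 dg_le0
      ddG_ge0 eig phi_gt0 phi_int1 lam_ge0 u0i u0_ge0 sol).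
have lam_ge0 := ltW lam0.
(* A value of g below this threshold means lam delta / g - mu > 10. Growing at rate at least 10 from
   a1 while staying below 1, E exhausts the gap 1 - a1 by time (1 - a1) / 10. *)
have c0 : 0 < lam * delta / (mu + 10) by rewrite divr_gt0 ?mulr_gt0//; lra.
have [a1 [a11 ga]] : exists a1, a1 < 1 /\ g a1 < lam * delta / (mu + 10).
  near (1 : R)^'- => s; exists s; split; first by near: s; exact: nbhs_left_lt.
  near: s; have : \forall y \near (0 : R), y < lam * delta / (mu + 10).
    exact: lt_nbhsl.
  exact: g1.
have Ga : 10 <= lam * delta * (g a1)^-1 - mu.
  have ga0 := g_gt0 _ a11.
  rewrite lerBrDr addrC ler_pdivlMr//; move: ga; rewrite ltr_pdivlMr; last lra.
  by move=> /ltW; rewrite mulrC.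
exists a1; split=> // u0 T u u0i u0_ge0 a1E sol _.
apply: time_interval_le; first by rewrite lee_fin divr_ge0// subr_ge0 ltW.
move=> t Tt; rewrite lee_fin ler_pdivlMr// mulrC.
apply: (time_bound_large C2g g_gt0 dg_le0 lam_ge0 delta0 mu_ge0 _ _ _ a11 a1E Ga Tt).
- exact: (energy_bounds oOm bOm oB BOm f_ge0 g_gt0 eig phi_gt0 phi_int1 lam_ge0 u0i u0_ge0 sol).
- exact: (energy_initial oOm bOm oB BOm f_ge0 g_gt0 eig phi_gt0 lam_ge0 u0i u0_ge0 sol).
- exact: (energy_inequality oOm bOm oB BOm f_ge0 delta0 f_delta C2g g_gt0 dg_le0
    ddG_ge0 eig phi_gt0 phi_int1 lam_ge0 u0i u0_ge0 sol).
Unshelve. all: end_near. Qed.
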